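(* Let $\mathcal{X}=\mathbb{R}^{n}$, $n\ge1$, and $d(x,y)=\Vert x-y\Vert_{2}^{q}$, where $0<q<1$. Then there exists a bi-Lipschitz embedding function of the metric space $(\mathcal{P}_{d}(\mathcal{X}),C_{d}^{*})$ into $L_{1}$ with distortion at most $10.55\,n^{q/2}/(1-q)$.
   Context: $\mathcal{P}(\mathcal{X})$ is the set of all Borel probability distributions over $\mathcal{X}$, and $\mathcal{P}_{d}(\mathcal{X}):=\{P\in\mathcal{P}(\mathcal{X}):\int\int d(x,y)P(\mathrm{d}x)P(\mathrm{d}y)<\infty\}$ (here, the distributions with finite $q$-th absolute moment). $C_d^*(P,Q):=\inf\mathbf{E}[d(X,Y)]$, the infimum being over all couplings $(X,Y)$ with $X\sim P$, $Y\sim Q$ (the 1-Wasserstein distance with respect to $d$). $L_1$ is the space of Lebesgue measurable functions $f:[0,1]\to\mathbb{R}$ with $\Vert f\Vert_1=\int_0^1|f(t)|\mathrm{d}t<\infty$, with the metric $\Vert f-g\Vert_1$. A function $f$ from a metric space $(\mathcal{X},d_{\mathcal{X}})$ to a metric space $(\mathcal{Y},d_{\mathcal{Y}})$ is $(r_1,r_2)$-bi-Lipschitz, $r_1,r_2>0$, if $r_2^{-1}d_{\mathcal{X}}(x_1,x_2)\le d_{\mathcal{Y}}(f(x_1),f(x_2))\le r_1 d_{\mathcal{X}}(x_1,x_2)$ for all $x_1,x_2\in\mathcal{X}$. The distortion of $f$ is the infimum of $r_1r_2$ over all $(r_1,r_2)$ such that $f$ is $(r_1,r_2)$-bi-Lipschitz.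 *)

(* Defs.v *)
(* Libraries: MathComp and MathComp-Analysis. *)
From HB Require Import structures.
From mathcomp Require Import all_boot all_order all_algebra.
From mathcomp Require Import all_classical all_reals all_analysis.
Import Order.TTheory GRing.Theory Num.Theory.
Import numFieldNormedType.Exports.

Set Implicit Arguments.
Unset Strict Implicit.
Unset Printing Implicit Defensive.

Local Open Scope classical_set_scope.
Local Open Scope ring_scope.

(* Distances take values in [\bar R], so that optimal costs and integrals need
   not be truncated by [fine].  The spaces below carry their points as
   representatives: a [probability] is a function on all sets, and an element of
   [L1] is a function rather than an a.e. class. *)
Section BiLipschitz.
Context {R : realType} {X Y : Type}.
Variables (dX : X -> X -> \bar R) (dY : Y -> Y -> \bar R).

Definition bi_lipschitz (r1 r2 : R) (f : X -> Y) : Prop :=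
  [/\ 0 < r1, 0 < r2 &
    forall x1 x2 : X,
      ((r2^-1)%:E * dX x1 x2 <= dY (f x1) (f x2))%E /\
      (dY (f x1) (f x2) <= r1%:E * dX x1 x2)%E].

(* Equal to +oo when [f] is not bi-Lipschitz. *)
Definition distortion (f : X -> Y) : \bar R :=
  ereal_inf [set e | exists r1 r2 : R,
    bi_lipschitz r1 r2 f /\ e = (r1 * r2)%:E].

End BiLipschitz.

Section Transport.
Context {R : realType} {disp : measure_display} {T : measurableType disp}.
Variable d : T -> T -> R.

Definition finite_mean_dist (P : probability T R) : Prop :=
  (\int[P]_y \int[P]_x (d x y)%:E < +oo)%E.

Definition Pd : Type := {P : probability T R | finite_mean_dist P}.

(* A coupling is a pair of random variables on an arbitrary common probability
   space; laws are compared on measurable sets only. *)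
Definition transport_cost (P Q : probability T R) : \bar R :=
  ereal_inf [set c | exists (dO : measure_display) (O : measurableType dO)
      (mu : probability O R) (X Y : {RV mu >-> T}),
    [/\ forall A, measurable A -> distribution mu X A = P A,
        forall A, measurable A -> distribution mu Y A = Q A &
        c = 'E_mu[fun w => d (X w) (Y w)]%E]].

Definition Pd_dist (P Q : Pd) : \bar R := transport_cost (sval P) (sval Q).

End Transport.
Arguments Pd {R disp T} d.
Arguments Pd_dist {R disp T} d.

Section Euclidean.
Variables (R : realType) (n : nat).

(* R^n with the sigma-algebra generated by its open sets. *)
Definition borelRn : measurableType _ :=
  g_sigma_algebraType (@open 'rV[R]_n).

Definition norm2 (x : 'rV[R]_n) : R := Num.sqrt (\sum_(i < n) x ord0 i ^+ 2).

Definition pow_dist (q : R) (x y : borelRn) : R :=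
  norm2 ((x : 'rV[R]_n) - (y : 'rV[R]_n)) `^ q.

End Euclidean.
Arguments pow_dist {R} n q.

Section L1.
Variable R : realType.

(* [lebesgue_measure] lives on the Borel sigma-algebra; its completion is used
   to allow all Lebesgue measurable functions.  Values outside [0, 1] are
   irrelevant. *)
Definition L1 : Type :=
  {f : R -> R |
    (@completed_lebesgue_measure R).-integrable `[0, 1] (EFin \o f)}.

Definition L1_dist (f g : L1) : \bar R :=
  (\int[@completed_lebesgue_measure R]_(t in `[0%R, 1%R])
     `|sval f t - sval g t|%:E)%E.

End L1.

(* Main.v *)
Require Import Defs.
From HB Require Import structures.
From mathcomp Require Import all_boot all_order all_algebra.
From mathcomp Require Import all_classical all_reals all_analysis.
From mathcomp Require Import measurable_realfun.
From mathcomp Require Import ring lra zify.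
Import Order.TTheory GRing.Theory Num.Theory.
Import numFieldNormedType.Exports.

Set Implicit Arguments.
Unset Strict Implicit.
Unset Printing Implicit Defensive.

Local Open Scope classical_set_scope.
Local Open Scope ring_scope.

(* Let [B] be the uniform quadratic B-spline and, for an integer level [k] and
   [c] in Z^n, put [phi_(k,c)(x) = \prod_i B(x_i / 2^k - c_i)].  The embedding
   sends [P] to the family [2^(kq) (P(phi_(k,c)) - phi_(k,c)(0))] in l1, and l1
   sits isometrically in L1 as step functions.

   Upper bound: [sqrt B] is Lipschitz, so the Hellinger distance between
   [phi_(k,.)(x)] and [phi_(k,.)(y)] is at most a constant times
   [||x - y||_2 / 2^k] independently of [n], hence
   [\sum_c |phi_(k,c)(x) - phi_(k,c)(y)| <= 2 min(1, sqrt 2 ||x - y||_2 / 2^k)].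
   Summing [2^(kq)] times this over [k] gives two geometric series, bounded by a
   multiple of [||x - y||_2^q]; integrate over a coupling.

   Lower bound: B-splines are refinable, so [phi_(k+1,c')] is a Markov average
   [\sum_c L(c,c') phi_(k,c)].  Starting from a fine level, match in each cell as
   much of [P] with [Q] as possible and send the rest up along [L].  The mass
   unmatched after level [k] is half of [\sum_c |P(phi_(k,c)) - Q(phi_(k,c))|], and
   mass matched at level [k] lies in the support of one [phi_(k,c)], so it travels
   at most [3 sqrt n 2^k].  Abel summation of the cost gives the bound, whose factor
   [2^q - 1] compensates the first geometric series as [q] tends to 0. *)

(** * Sums over countable types *)

Section esum_extra.
Local Open Scope ereal_scope.
Context {R : realType}.

(** Bridge to series indexed by [nat]: codes without a preimage contribute 0. Scaling and
    integration over a countable type thereby reduce to nonnegative series. *)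
Lemma esumT_pickle_inv (I : countType) (f : I -> \bar R) : (forall i, 0 <= f i) ->
  \esum_(i in [set: I]) f i = \sum_(k <oo) oapp f 0 (pickle_inv k).
Proof.
move=> f0; rewrite nneseries_esumT; last by move=> k; case: pickle_inv => //= i.
rewrite [RHS](esumID (range (@pickle I))); last first.
  by move=> k _; case: pickle_inv => //= i.
rewrite setTI [X in _ + X]esum1 ?adde0; last first.
  move=> k [_ /= nk]; case E : (pickle_inv k) => [i|] //=.
  exfalso; apply: nk; exists i => //.
  by have := @pickle_invK I k; rewrite E.
rewrite esum_image; last by move=> i j _ _; exact: (pcan_inj (@pickleK I)).
by apply: eq_esum => i _; rewrite pickleK_inv.
Qed.

Lemma exchange_esum (I J : choiceType) (f : I -> J -> \bar R) :
  (forall i j, 0 <= f i j) ->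
  \esum_(i in [set: I]) \esum_(j in [set: J]) f i j =
  \esum_(j in [set: J]) \esum_(i in [set: I]) f i j.
Proof.
move=> f0; rewrite !esum_esum//.
rewrite (reindex_esum ([set: J] `*`` fun=> [set: I]) _ (fun x => (x.2, x.1)))//.
split=> //=; first by move=> [i1 i2] [j1 j2] /= _ _ [] -> ->.
by move=> [i j] _ /=; exists (j, i).
Qed.

Lemma pair_esum (I J : choiceType) (f : I -> J -> \bar R) :
  (forall i j, 0 <= f i j) ->
  \esum_(i in [set: I]) \esum_(j in [set: J]) f i j =
  \esum_(k in [set: I * J]) f k.1 k.2.
Proof.
by move=> f0; rewrite esum_esum//; congr esum; apply/seteqP; split.
Qed.

Lemma esumZl (I : countType) (k : R) (f : I -> \bar R) :
  (forall i, 0 <= f i) -> (0 <= k)%R ->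
  \esum_(i in [set: I]) (k%:E * f i) = k%:E * \esum_(i in [set: I]) f i.
Proof.
move=> f0 k0; rewrite !esumT_pickle_inv//; last by move=> i; rewrite mule_ge0.
rewrite -nneseriesZl; last by move=> i _; case: pickle_inv => //= i0.
by apply: eq_eseriesr => i _; case: pickle_inv => //=; rewrite mule0.
Qed.

Lemma esum_finType (T : finType) (I : choiceType) (e : T -> I) (f : I -> \bar R) :
  injective e -> (forall i, 0 <= f i) -> (forall i, f i != 0 -> exists t, i = e t) ->
  \esum_(i in [set: I]) f i = \sum_(t : T) f (e t).
Proof.
move=> inje f0 fe; rewrite (esumID (range e))//.
rewrite setTI [X in _ + X]esum1 ?adde0; last first.
  move=> i [_ /= ni]; apply: contrapT => /eqP /fe [t it].
  by apply: ni; exists t.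
rewrite esum_image; last by move=> i j _ _; exact: inje.
have -> : [set: T] = [set i | i \in index_enum T].
  by apply/seteqP; split => // x _; rewrite /= mem_index_enum.
rewrite esum_fset//; first by rewrite -fsbig_seq// index_enum_uniq.
Qed.

End esum_extra.

Section esum_integral.
Local Open Scope ereal_scope.
Context d (T : measurableType d) (R : realType).

Lemma measurable_esum (I : countType) (f : I -> T -> \bar R) :
  (forall i x, 0 <= f i x) -> (forall i, measurable_fun setT (f i)) ->
  measurable_fun setT (fun x => \esum_(i in [set: I]) f i x).
Proof.
move=> f0 mf.
rewrite (_ : (fun x => _) = fun x => \sum_(k <oo) oapp (f ^~ x) 0 (pickle_inv k)); last first.
  by apply/funext => x; rewrite esumT_pickle_inv.
apply: ge0_emeasurable_sum => [k x _ _|k _]; first by case: pickle_inv => //= i.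
by case: pickle_inv.
Qed.

Lemma integral_esum (mu : {measure set T -> \bar R}) (D : set T) (I : countType)
    (f : I -> T -> \bar R) : measurable D ->
  (forall i x, 0 <= f i x) -> (forall i, measurable_fun setT (f i)) ->
  \int[mu]_(x in D) (\esum_(i in [set: I]) f i x) =
  \esum_(i in [set: I]) \int[mu]_(x in D) f i x.
Proof.
move=> mD f0 mf.
under eq_integral do rewrite esumT_pickle_inv//.
rewrite integral_nneseries//; last 2 first.
- move=> k; case: pickle_inv => [i|] /=; last exact: measurable_cst.
  exact: measurable_funTS.
- by move=> k x _; case: pickle_inv => //= i.
rewrite esumT_pickle_inv; last by move=> i; exact: integral_ge0.
apply: eq_eseriesr => k _; case: pickle_inv => //=.
by rewrite integral0.
Qed.

End esum_integral.


(** * Couplings from paired pieces *)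

Section measure_construction.
Local Open Scope ereal_scope.
Context d (T : measurableType d) (R : realType).

Lemma exists_density_measure (mu : {measure set T -> \bar R}) (f : T -> \bar R) :
  measurable_fun setT f -> (forall x, 0 <= f x) ->
  exists nu : {measure set T -> \bar R}, forall A, nu A = \int[mu]_(x in A) f x.
Proof.
move=> mf f0; pose nu (A : set T) := \int[mu]_(x in A) f x.
have nu0 : nu set0 = 0 by exact: integral_set0.
have nu_ge0 A : 0 <= nu A by exact: integral_ge0.
have nu_add : semi_sigma_additive nu by exact: semi_sigma_additive_nng_induced.
pose m : {measure set T -> \bar R} :=
  HB.pack nu (isMeasure.Build _ _ _ nu nu0 nu_ge0 nu_add).
by exists m.
Qed.

Lemma exists_probability (mu : {measure set T -> \bar R}) : mu [set: T] = 1 ->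
  exists P : probability T R, forall A, P A = mu A.
Proof.
move=> mu1.
exists (mnormalize mu (dirac point)) => A.
by rewrite /= /mnormalize mu1 onee_eq0/= invr1 mule1.
Qed.

End measure_construction.

Section pieces.
Local Open Scope ereal_scope.
Context d (T : measurableType d) (R : realType).
Variables (dst : T -> T -> R) (P Q : probability T R).
Hypothesis dst_ge0 : forall x y, (0 <= dst x y)%R.
Hypothesis mdst : measurable_fun setT (fun z : T * T => dst z.1 z.2).

(** The witness has density [M^-1 * g x * h y] with respect to the product of [P] and [Q].
    Inequalities for the marginals suffice, since the total masses will force equality. *)
Lemma exists_product_piece (g h : T -> \bar R) (M D : R) :
  (forall x, 0 <= g x) -> (forall x, 0 <= h x) ->
  measurable_fun setT g -> measurable_fun setT h ->
  \int[P]_x g x = M%:E -> \int[Q]_x h x = M%:E -> (0 <= D)%R ->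
  (forall x y, g x != 0 -> h y != 0 -> dst x y <= D)%R ->
  exists nu : {measure set (T * T) -> \bar R},
    [/\ forall A, measurable A -> nu (fst @^-1` A) <= \int[P]_(x in A) g x,
        forall A, measurable A -> nu (snd @^-1` A) <= \int[Q]_(x in A) h x,
        nu setT = M%:E &
        \int[nu]_z (dst z.1 z.2)%:E <= (D * M)%:E].
Proof.
move=> g0 h0 mg mh gM hM D0 gh.
have M0 : (0 <= M)%R by rewrite -lee_fin -gM integral_ge0.
pose f (z : T * T) := (M^-1)%:E * (g z.1 * h z.2).
have f0 z : 0 <= f z by rewrite !mule_ge0// lee_fin invr_ge0.
have mf : measurable_fun setT f.
  apply: emeasurable_funM => //.
  by apply: emeasurable_funM; exact: measurableT_comp.
have [nu nuE] := exists_density_measure (P \x Q)%E mf f0.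
have nu1 A : measurable A -> nu (fst @^-1` A) = (M^-1 * M)%:E * \int[P]_(x in A) g x.
  move=> mA; rewrite nuE.
  have mA2 : measurable (@fst T T @^-1` A).
    by rewrite -[X in measurable X]setTI; apply: measurable_fst.
  rewrite integral_mkcond fubini_tonelli1//=; last 2 first.
  - by apply/(measurable_restrictT _ _).1 => //; exact: measurable_funTS.
  - by move=> z; rewrite patchE; case: ifP.
  rewrite /fubini_F.
  rewrite [in RHS]integral_mkcond -ge0_integralZl//; last 3 first.
  - by apply/(measurable_restrictT _ _).1 => //; exact: measurable_funTS.
  - by move=> x _; rewrite patchE; case: ifP.
  - by rewrite lee_fin mulr_ge0 ?invr_ge0.
  apply: eq_integral => x _.
  rewrite patchE; case: ifPn => xA.
    under eq_integral => y _.
      rewrite patchE ifT; last by rewrite inE /=; move: xA; rewrite inE.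
      rewrite /f /= muleA; over.
    rewrite ge0_integralZl//; last first.
      by rewrite mule_ge0// lee_fin invr_ge0.
    by rewrite hM EFinM muleAC.
  rewrite integral0_eq ?mule0// => y _.
  rewrite patchE ifF//; apply/negP; rewrite inE /= => Ax.
  by move/negP: xA; apply; rewrite inE.
have nu2 A : measurable A -> nu (snd @^-1` A) = (M^-1 * M)%:E * \int[Q]_(x in A) h x.
  move=> mA; rewrite nuE.
  have mA2 : measurable (@snd T T @^-1` A).
    by rewrite -[X in measurable X]setTI; apply: measurable_snd.
  rewrite integral_mkcond fubini_tonelli2//=; last 2 first.
  - by apply/(measurable_restrictT _ _).1 => //; exact: measurable_funTS.
  - by move=> z; rewrite patchE; case: ifP.
  rewrite /fubini_G.
  rewrite [in RHS]integral_mkcond -ge0_integralZl//; last 3 first.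
  - by apply/(measurable_restrictT _ _).1 => //; exact: measurable_funTS.
  - by move=> x _; rewrite patchE; case: ifP.
  - by rewrite lee_fin mulr_ge0 ?invr_ge0.
  apply: eq_integral => y _.
  rewrite patchE; case: ifPn => xA.
    under eq_integral => x _.
      rewrite patchE ifT; last by rewrite inE /=; move: xA; rewrite inE.
      rewrite /f /= muleA muleAC; over.
    rewrite ge0_integralZl//; last first.
      by rewrite mule_ge0// lee_fin invr_ge0.
    by rewrite gM EFinM muleAC.
  rewrite integral0_eq ?mule0// => x _.
  rewrite patchE ifF//; apply/negP; rewrite inE /= => Ax.
  by move/negP: xA; apply; rewrite inE.
(* The product is 1, or 0 when [M = 0], by the convention [0^-1 = 0]. *)
have MM : (M^-1 * M <= 1)%R.
  by have [->|M1] := eqVneq M 0%R; rewrite ?mulr0// mulVf.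
have nuT : nu setT = M%:E.
  rewrite -[setT](preimage_setT fst) nu1// gM -EFinM.
  by have [->|M1] := eqVneq M 0%R; rewrite ?mulr0// mulVf// mul1r.
exists nu; split => //.
- move=> A mA; rewrite nu1// -[leRHS]mul1e lee_wpmul2r ?lee_fin//.
  exact: integral_ge0.
- move=> A mA; rewrite nu2// -[leRHS]mul1e lee_wpmul2r ?lee_fin//.
  exact: integral_ge0.
(* [N] is null for [nu], and off [N] both densities are nonzero, so the cost there is at most
   [D]. *)
- pose N := [set z | f z = 0].
  have mN : measurable N.
    by rewrite -[N]setTI; exact: emeasurable_fun_eq (measurable_cst _).
  have mE : measurable_fun setT (fun z : T * T => (dst z.1 z.2)%:E).
    exact/measurable_EFinP.
  rewrite (ge0_negligible_integral mN)//; last 2 first.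
  - by move=> z _; rewrite lee_fin.
  - by rewrite nuE integral0_eq.
  apply: (@le_trans _ _ (\int[nu]_(z in setT `\` N) D%:E)).
    apply: ge0_le_integral => //.
    + exact: measurableD.
    + by move=> z _; rewrite lee_fin.
    + exact: measurable_funTS.
    + move=> z [_ /= fz]; rewrite lee_fin; apply: gh; apply/eqP => e; apply: fz.
      * by rewrite /N /= /f e mul0e mule0.
      * by rewrite /N /= /f e mule0 mule0.
  rewrite integral_cst//; last exact: measurableD.
  rewrite EFinM -nuT lee_wpmul2l ?lee_fin//.
  by apply: le_measure; rewrite ?inE//; exact: measurableD.
Qed.

(* The coupling is the sum of the rescaled products of the paired pieces.  Its
   marginals are dominated by [P] and [Q] and have the same total mass, which
   forces equality. *)
Lemma transport_cost_le_pieces (g h : nat -> T -> \bar R) (M D : nat -> R) :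
  (forall k x, 0 <= g k x) -> (forall k x, 0 <= h k x) ->
  (forall k, measurable_fun setT (g k)) -> (forall k, measurable_fun setT (h k)) ->
  (forall k, \int[P]_x g k x = (M k)%:E) -> (forall k, \int[Q]_x h k x = (M k)%:E) ->
  (forall k, 0 <= D k)%R ->
  (forall k x y, g k x != 0 -> h k y != 0 -> dst x y <= D k)%R ->
  (forall x, \sum_(k <oo) g k x <= 1) -> (forall x, \sum_(k <oo) h k x <= 1) ->
  \sum_(k <oo) (M k)%:E = 1 ->
  transport_cost dst P Q <= \sum_(k <oo) (D k * M k)%:E.
Proof.
move=> g0 h0 mg mh gM hM D0 gh g1 h1 M1.
have [nu nuP] := choice (fun k => exists_product_piece (g0 k) (h0 k) (mg k) (mh k)
  (gM k) (hM k) (D0 k) (gh k)).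
have nuT : mseries nu 0 [set: T * T] = 1.
  by rewrite -M1; apply: eq_eseriesr => k _; case: (nuP k).
have [mu muE] := exists_probability nuT.
have le_law (m : probability T R) (f : nat -> T -> \bar R) (p : T * T -> T) :
    measurable_fun setT p ->
    (forall k x, 0 <= f k x) -> (forall k, measurable_fun setT (f k)) ->
    (forall x, \sum_(k <oo) f k x <= 1) ->
    (forall k A, measurable A -> nu k (p @^-1` A) <= \int[m]_(x in A) f k x) ->
    forall A, measurable A -> mu (p @^-1` A) = m A.
  move=> mp f0 mf f1 nuf.
  have le A : measurable A -> mu (p @^-1` A) <= m A.
    move=> mA; rewrite muE /mseries.
    apply: (@le_trans _ _ (\sum_(k <oo) \int[m]_(x in A) f k x)).
      by apply: lee_nneseries => // k _; exact: nuf.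
    rewrite -integral_nneseries//; last by move=> k; exact: measurable_funTS.
    rewrite -[leRHS]mul1e -integral_cst//; apply: ge0_le_integral => //.
    + by move=> x _; exact: nneseries_ge0.
    + apply: measurable_funTS; exact: ge0_emeasurable_sum.
  move=> A mA; apply/eqP; rewrite eq_le le//=.
  have mpA : measurable (p @^-1` A) by rewrite -[X in measurable X]setTI; exact: mp.
  (* Domination on the complement is the reverse inequality on [A], both measures having mass 1. *)
  have := le _ (measurableC mA).
  by rewrite preimage_setC !probability_setC// leeD2lE// leeN2.
have lawP := le_law P g fst measurable_fst g0 mg g1
  (fun k => let: And4 a _ _ _ := nuP k in a).
have lawQ := le_law Q h snd measurable_snd h0 mh h1
  (fun k => let: And4 _ b _ _ := nuP k in b).
pose X : {mfun (T * T)%type >-> T} :=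
  HB.pack (@fst T T) (isMeasurableFun.Build _ _ _ _ (@fst T T) measurable_fst).
pose Y : {mfun (T * T)%type >-> T} :=
  HB.pack (@snd T T) (isMeasurableFun.Build _ _ _ _ (@snd T T) measurable_snd).
apply: (@le_trans _ _ ('E_mu[fun w => dst (X w) (Y w)])).
  apply: ereal_inf_lbound; exists _, (T * T)%type, mu, X, Y; split => //.
rewrite unlock /=.
rewrite (eq_measure_integral (mseries nu 0))/=; last by move=> A _ _; rewrite muE.
rewrite ge0_integral_measure_series//; last 2 first.
- by move=> z _; rewrite lee_fin.
- exact/measurable_EFinP.
apply: lee_nneseries => [k _ _|k _]; last by case: (nuP k).
by apply: integral_ge0 => z _; rewrite lee_fin.
Qed.

End pieces.

(** * Multiscale matching *)

Section discrete_matching.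
Local Open Scope ereal_scope.
Context {R : realType} (I : countType).
Variable L : I -> I -> R.
Hypothesis L_ge0 : forall c c', (0 <= L c c')%R.
Hypothesis L1 : forall c, \esum_(c' in [set: I]) (L c c')%:E = 1.
Implicit Types p q : nat -> I -> R.

(* [p j c] and [q j c] are the masses that two laws put on cell [c] at level [j].
   Matching as much as possible in every cell leaves the excess, which moves up
   along the kernel [L]; [mass] is what then arrives at level [j]. *)
Definition excess p q j c : R := (Num.max (p j c - q j c) 0)%R.

Fixpoint mass p q j : I -> R :=
  if j is i.+1 then
    fun c' => fine (\esum_(c in [set: I]) (L c c' * excess p q i c)%:E)
  else p 0%N.

Definition consistent p := [/\ forall j c, (0 <= p j c)%R,
  forall j, \esum_(c in [set: I]) (p j c)%:E = 1 &
  forall j c', \esum_(c in [set: I]) (L c c' * p j c)%:E = (p j.+1 c')%:E].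

Lemma excess_ge0 p q j c : (0 <= excess p q j c)%R.
Proof. by rewrite le_max lexx orbT. Qed.

Lemma excess_le p q j c : (0 <= p j c)%R -> (0 <= q j c)%R ->
  (excess p q j c <= p j c)%R.
Proof. by move=> p0 q0; rewrite ge_max p0 gerBl q0. Qed.

Lemma excess_sub p q j c : (excess p q j c - excess q p j c = p j c - q j c)%R.
Proof.
by rewrite /excess; case: (leP (p j c - q j c)%R); case: (leP (q j c - p j c)%R); lra.
Qed.

Lemma excess_add p q j c : (excess p q j c + excess q p j c = `|p j c - q j c|)%R.
Proof.
rewrite /excess; case: (leP (p j c - q j c)%R) => h.
  by rewrite ler0_norm//; case: (leP (q j c - p j c)%R); lra.
by rewrite gtr0_norm//; case: (leP (q j c - p j c)%R); lra.
Qed.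

(** The [fine] in [mass] loses nothing: the excess is at most [p], so the sum is at most
    [p j.+1 c']. *)
Lemma massS p q : consistent p -> consistent q -> forall j c',
  (mass p q j.+1 c')%:E = \esum_(c in [set: I]) (L c c' * excess p q j c)%:E.
Proof.
move=> [p0 _ pL] [q0 _ _] j c'; rewrite /= fineK// ge0_fin_numE; last first.
  by apply: esum_ge0 => c _; rewrite lee_fin mulr_ge0// excess_ge0.
apply: (@le_lt_trans _ _ (p j.+1 c')%:E); last exact: ltry.
by rewrite -pL; apply: le_esum => c _; rewrite lee_fin ler_wpM2l// excess_le.
Qed.

Lemma mass_ge0 p q : consistent p -> consistent q -> forall j c, (0 <= mass p q j c)%R.
Proof.
move=> cp cq [|j] c; first by case: cp => p0 _ _; exact: p0.
rewrite -lee_fin massS//; apply: esum_ge0 => c' _.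
by rewrite lee_fin mulr_ge0// excess_ge0.
Qed.

(* Matching removes equal amounts from both sides, so differences still obey the
   same recursion as [p - q]. *)
Lemma mass_sub p q : consistent p -> consistent q -> forall j c,
  (mass p q j c - mass q p j c = p j c - q j c)%R.
Proof.
move=> cp cq [|j] c; first by [].
have [p0 _ pL] := cp; have [q0 _ qL] := cq.
suff: (mass p q j.+1 c + q j.+1 c = mass q p j.+1 c + p j.+1 c)%R by lra.
apply: EFin_inj; rewrite !EFinD !massS// -pL -qL.
have mg0 a b c' : (0 <= a)%R -> (0 <= b)%R -> 0 <= (a * b)%:E.
  by move=> ? ?; rewrite lee_fin mulr_ge0.
rewrite -!esumD => [|c' _|c' _|c' _|c' _]; last 4 first.
- by rewrite lee_fin mulr_ge0 ?excess_ge0.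
- by rewrite lee_fin mulr_ge0.
- by rewrite lee_fin mulr_ge0 ?excess_ge0.
- by rewrite lee_fin mulr_ge0.
apply: eq_esum => c' _; rewrite -!EFinD -!mulrDr.
by have := excess_sub p q j c' => ?; congr (_ * _)%:E; lra.
Qed.

(** By [mass_sub] the excess is the positive part of a difference of two nonnegative masses, hence
    at most the first of them. *)
Lemma excess_le_mass p q : consistent p -> consistent q -> forall j c,
  (excess p q j c <= mass p q j c)%R.
Proof.
move=> cp cq j c; rewrite ge_max mass_ge0// andbT -mass_sub//.
by rewrite gerBl mass_ge0.
Qed.

(** For consistent [p] and [q] this is the minimum of [mass p q j c] and [mass q p j c]. *)
Definition matched p q j c : R := (mass p q j c - excess p q j c)%R.

Lemma matched_ge0 p q : consistent p -> consistent q -> forall j c,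
  (0 <= matched p q j c)%R.
Proof. by move=> cp cq j c; rewrite subr_ge0 excess_le_mass. Qed.

Lemma matchedC p q : consistent p -> consistent q -> forall j c,
  matched p q j c = matched q p j c.
Proof.
move=> cp cq j c; rewrite /matched.
by have := excess_sub p q j c; have := mass_sub cp cq j c; lra.
Qed.

Definition unmatched p q j : R :=
  (fine (\esum_(c in [set: I]) `|p j c - q j c|%:E) / 2)%R.

Lemma esum_dist_fin p q : consistent p -> consistent q -> forall j,
  \esum_(c in [set: I]) `|p j c - q j c|%:E \is a fin_num.
Proof.
move=> [p0 p1 _] [q0 q1 _] j; rewrite ge0_fin_numE; last by apply: esum_ge0 => c _;
  rewrite lee_fin.
apply: (@le_lt_trans _ _ (1 + 1)); last by rewrite -EFinD ltry.
rewrite -[X in X + _](p1 j) -(q1 j) -esumD => [|c _|c _]; rewrite ?lee_fin//.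
apply: le_esum => c _; rewrite -EFinD lee_fin.
by rewrite (le_trans (ler_normB _ _))// !ger0_norm.
Qed.

(** The two excesses have equal totals, because both laws have mass 1, and together they make up the
    l1 distance. *)
Lemma esum_excess p q : consistent p -> consistent q -> forall j,
  \esum_(c in [set: I]) (excess p q j c)%:E = (unmatched p q j)%:E.
Proof.
move=> cp cq j; have [p0 p1 _] := cp; have [q0 q1 _] := cq.
have fin a b : consistent a -> consistent b ->
  \esum_(c in [set: I]) (excess a b j c)%:E \is a fin_num.
  move=> [a0 a1 _] [b0 b1 _].
  rewrite ge0_fin_numE; last by apply: esum_ge0 => c _; rewrite lee_fin excess_ge0.
  apply: (@le_lt_trans _ _ 1); last exact: ltry.
  by rewrite -(a1 j); apply: le_esum => c _; rewrite lee_fin excess_le.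
have e1 : \esum_(c in [set: I]) (excess p q j c)%:E + 1 =
    \esum_(c in [set: I]) (excess q p j c)%:E + 1.
  rewrite -[in LHS](q1 j) -[in RHS](p1 j) -!esumD => [|c _|c _|c _|c _];
    rewrite ?lee_fin ?excess_ge0//.
  by apply: eq_esum => c _; rewrite -!EFinD; have := excess_sub p q j c => ?;
    congr _%:E; lra.
have e2 : \esum_(c in [set: I]) (excess p q j c)%:E +
    \esum_(c in [set: I]) (excess q p j c)%:E =
    \esum_(c in [set: I]) `|p j c - q j c|%:E.
  rewrite -esumD => [|c _|c _]; rewrite ?lee_fin ?excess_ge0//.
  by apply: eq_esum => c _; rewrite -EFinD excess_add.
rewrite /unmatched -e2 fineD//; try exact: fin.
move: e1; rewrite -(fineK (fin p q cp cq)) -(fineK (fin q p cq cp)) -!EFinD => -[e1].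
by rewrite /=; congr _%:E; lra.
Qed.

(** A Markov kernel preserves total mass. *)
Lemma esum_massS p q : consistent p -> consistent q -> forall j,
  \esum_(c in [set: I]) (mass p q j.+1 c)%:E = (unmatched p q j)%:E.
Proof.
move=> cp cq j; rewrite -esum_excess//.
under eq_esum do rewrite massS//.
rewrite exchange_esum; last by move=> c c'; rewrite lee_fin mulr_ge0 ?excess_ge0.
apply: eq_esum => c _; under eq_esum do rewrite mulrC EFinM.
rewrite esumZl ?excess_ge0//; last by move=> c'; rewrite lee_fin.
by rewrite L1 mule1.
Qed.

Lemma unmatched_ge0 p q j : (0 <= unmatched p q j)%R.
Proof. by rewrite divr_ge0// fine_ge0// esum_ge0// => c _; rewrite lee_fin. Qed.

Lemma esum_matched p q : consistent p -> consistent q -> forall j,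
  \esum_(c in [set: I]) (matched p q j c)%:E =
  ((if j is i.+1 then unmatched p q i else 1) - unmatched p q j)%:E.
Proof.
move=> cp cq j; have [p0 p1 _] := cp.
have : \esum_(c in [set: I]) (matched p q j c)%:E + \esum_(c in [set: I]) (excess p
  q j c)%:E
   = (if j is i.+1 then unmatched p q i else 1)%:E.
  rewrite -esumD => [|c _|c _]; rewrite ?lee_fin ?excess_ge0// ?matched_ge0//.
  rewrite [LHS](_ : _ = \esum_(c in [set: I]) (mass p q j c)%:E).
    by case: j => [|j]; [exact: p1|exact: esum_massS].
  by apply: eq_esum => c _; rewrite -EFinD subrK.
by rewrite esum_excess// => /eqP; rewrite eq_sym -sube_eq// ?EFinB => [/eqP<-//|];
  rewrite fin_num_adde_defl.
Qed.

End discrete_matching.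

Lemma integral_probability1 d (T : measurableType d) (R : realType)
  (P : probability T R) : (\int[P]_x 1 = 1)%E.
Proof. by rewrite integral_cst// mul1e; exact: probability_setT. Qed.

(** * Realising the discrete matching by densities *)

Section flow.
Local Open Scope ereal_scope.
Context d (T : measurableType d) (R : realType) (I : countType).
Variables (phi : nat -> I -> T -> R) (L : I -> I -> R).
Hypothesis L_ge0 : forall c c', (0 <= L c c')%R.
Hypothesis L1 : forall c, \esum_(c' in [set: I]) (L c c')%:E = 1.
Hypothesis phi_ge0 : forall j c x, (0 <= phi j c x)%R.
Hypothesis mphi : forall j c, measurable_fun setT (phi j c).
Hypothesis phi1 : forall j x, \esum_(c in [set: I]) (phi j c x)%:E = 1.
Hypothesis phiL : forall j c' x,
  \esum_(c in [set: I]) (L c c' * phi j c x)%:E = (phi j.+1 c' x)%:E.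

Section one_sided.
Variable u : nat -> I -> R.
Hypothesis u01 : forall j c, (0 <= u j c <= 1)%R.

(* With [u j c] the fraction left unmatched in cell [c] at level [j], [flow j c]
   is the density of the mass present in [c] before matching at level [j]. *)
Fixpoint flow j : I -> T -> \bar R :=
  if j is i.+1 then
    fun c' x => \esum_(c in [set: I]) ((L c c' * u i c)%:E * flow i c x)
  else fun c x => (phi 0 c x)%:E.

Let u_ge0 j c : (0 <= u j c)%R. Proof. by case/andP: (u01 j c). Qed.

Lemma flow_ge0 j c x : 0 <= flow j c x.
Proof.
elim: j c => [c|j ih c] /=; first by rewrite lee_fin.
by apply: esum_ge0 => c' _; rewrite mule_ge0// lee_fin mulr_ge0.
Qed.

Lemma measurable_flow j c : measurable_fun setT (flow j c).
Proof.
elim: j c => [c|j ih c] /=; first exact/measurable_EFinP.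
apply: measurable_esum => c'; last exact: measurable_funeM.
by move=> x; rewrite mule_ge0 ?flow_ge0// lee_fin mulr_ge0.
Qed.

(** Keeping everything, [u = 1], would reproduce [phi] by [phiL]. The bound makes [flow] finite and
    confines it to the support of [phi j c]. *)
Lemma flow_le j c x : flow j c x <= (phi j c x)%:E.
Proof.
elim: j c => [c|j ih c] //=; rewrite -phiL; apply: le_esum => c' _.
rewrite [leRHS]EFinM; apply: lee_pmul; rewrite ?lee_fin ?mulr_ge0 ?flow_ge0//.
by rewrite ler_piMr//; case/andP: (u01 j c').
Qed.

(** Density of the mass that is matched in [c] at level [j] and leaves the flow there. *)
Definition settled j c x : \bar R := (1 - u j c)%:E * flow j c x.

Lemma settled_ge0 j c x : 0 <= settled j c x.
Proof.
by rewrite mule_ge0 ?flow_ge0// lee_fin subr_ge0; case/andP: (u01 j c).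
Qed.

Lemma measurable_settled j c : measurable_fun setT (settled j c).
Proof. exact/measurable_funeM/measurable_flow. Qed.

Lemma esum_flowS j x : \esum_(c in [set: I]) flow j.+1 c x =
  \esum_(c in [set: I]) ((u j c)%:E * flow j c x).
Proof.
rewrite /= exchange_esum; last first.
  by move=> c c'; rewrite mule_ge0 ?flow_ge0// lee_fin mulr_ge0.
apply: eq_esum => c _.
under eq_esum do rewrite mulrC EFinM muleAC.
have : flow j c x \is a fin_num.
  by rewrite ge0_fin_numE ?flow_ge0// (le_lt_trans (flow_le _ _ _))// ltry.
move=> /fineK <-; rewrite -EFinM esumZl ?L1 ?mule1//.
  by move=> c'; rewrite lee_fin.
by rewrite mulr_ge0// fine_ge0// flow_ge0.
Qed.

Lemma sum_settled N x :
  \sum_(j < N) \esum_(c in [set: I]) settled j c x +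
  \esum_(c in [set: I]) flow N c x = 1.
Proof.
elim: N => [|N ih]; first by rewrite big_ord0 add0e /= phi1.
rewrite big_ord_recr /= -ih -addeA; congr (_ + _).
rewrite -/(flow N.+1) esum_flowS -esumD => [|c _|c _]; last 2 first.
- exact: settled_ge0.
- by rewrite mule_ge0 ?flow_ge0// lee_fin.
apply: eq_esum => c _; rewrite /settled -ge0_muleDl ?lee_fin//.
  by rewrite -EFinD subrK mul1e.
by rewrite subr_ge0; case/andP: (u01 N c).
Qed.

(** Conservation of mass up to each finite level bounds the partial sums. Some mass could remain in
    the flow at [x]; that the total is 1 follows later from the decay of [unmatched]. *)
Lemma esum_settled_le1 x :
  \esum_(jc in [set: nat * I]) settled jc.1 jc.2 x <= 1.
Proof.
rewrite -(pair_esum (fun j c => settled_ge0 j c x)) -nneseries_esumT; last first.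
  by move=> j; apply: esum_ge0 => c _; exact: settled_ge0.
apply: lime_le.
  by apply: is_cvg_nneseries => j _ _; apply: esum_ge0 => c _; exact: settled_ge0.
apply: nearW => N; rewrite -(sum_settled N x) big_mkord leeDl//.
by apply: esum_ge0 => c _; exact: flow_ge0.
Qed.

End one_sided.

Definition level_mass (P : probability T R) j c : R :=
  fine (\int[P]_x (phi j c x)%:E).

Lemma phi_le1 j c x : (phi j c x <= 1)%R.
Proof.
rewrite -lee_fin -(phi1 j x) (esumID [set c])//; last by move=> ? _; rewrite lee_fin.
rewrite setTI esum_set1 ?lee_fin// leeDl//.
by apply: esum_ge0 => ? _; rewrite lee_fin.
Qed.

Lemma level_massE P j c :
  (level_mass P j c)%:E = \int[P]_x (phi j c x)%:E.
Proof.
rewrite /level_mass fineK// ge0_fin_numE; last first.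
  by apply: integral_ge0 => x _; rewrite lee_fin.
apply: (@le_lt_trans _ _ (\int[P]_x 1)).
  apply: ge0_le_integral => //.
  - by move=> x _; rewrite lee_fin.
  - exact/measurable_EFinP.
  - by move=> x _; rewrite lee_fin phi_le1.
by rewrite integral_probability1 ltry.
Qed.

Lemma consistent_level_mass P : consistent L (level_mass P).
Proof.
have mE j c : measurable_fun setT (fun x => (phi j c x)%:E) by exact/measurable_EFinP.
split=> [j c|j|j c'].
- by rewrite /level_mass fine_ge0// integral_ge0// => x _; rewrite lee_fin.
- under eq_esum do rewrite level_massE.
  rewrite -integral_esum//; last by move=> c x; rewrite lee_fin.
  under eq_integral do rewrite phi1.
  exact: integral_probability1.
- transitivity (\esum_(c in [set: I]) \int[P]_x ((L c c')%:E * (phi j c x)%:E)).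
    apply: eq_esum => c _; rewrite EFinM level_massE ge0_integralZl_EFin//.
    by move=> x _; rewrite lee_fin.
  rewrite -integral_esum//.
  + rewrite level_massE; apply: eq_integral => x _; rewrite -phiL.
    by apply: eq_esum => c _; rewrite EFinM.
  + by move=> c x; rewrite mule_ge0 ?lee_fin.
  + by move=> c; exact: measurable_funeM.
Qed.

(* Junk value: the fraction is [0] where the mass vanishes; [kept_mass] holds
   nonetheless because the excess vanishes there too. *)
Definition kept (p q : nat -> I -> R) j c : R := excess p q j c / mass L p q j c.

Lemma kept01 p q : consistent L p -> consistent L q -> forall j c,
  (0 <= kept p q j c <= 1)%R.
Proof.
move=> cp cq j c; have m0 := mass_ge0 L_ge0 cp cq j c.
rewrite /kept divr_ge0 ?excess_ge0//=.
have [->|mn0] := eqVneq (mass L p q j c) 0%R; first by rewrite invr0 mulr0.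
by rewrite ler_pdivrMr ?mul1r ?excess_le_mass// lt_def mn0.
Qed.

Lemma kept_mass p q : consistent L p -> consistent L q -> forall j c,
  (kept p q j c * mass L p q j c = excess p q j c)%R.
Proof.
move=> cp cq j c; have := excess_le_mass L_ge0 cp cq j c.
rewrite /kept; have [->|mn0] := eqVneq (mass L p q j c) 0%R; last by rewrite divfK.
by rewrite mulr0 => h; apply/eqP; rewrite eq_sym eq_le h excess_ge0.
Qed.

(** Integrating the recursion of [flow] gives that of [mass], because [kept] times [mass] is the
    excess. *)
Lemma integral_flow (P : probability T R) q : consistent L q -> forall j c,
  let p := level_mass P in
  \int[P]_x flow (kept p q) j c x = (mass L p q j c)%:E.
Proof.
move=> cq j c p; have cp : consistent L p := consistent_level_mass P.
have k01 := kept01 cp cq.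
have k0 i c' : (0 <= kept p q i c')%R by case/andP: (k01 i c').
elim: j c => [c|j ih c]; first by rewrite /= level_massE.
rewrite massS//= integral_esum//; last 2 first.
- by move=> c' x; rewrite mule_ge0 ?flow_ge0// lee_fin mulr_ge0.
- by move=> c'; exact/measurable_funeM/measurable_flow.
apply: eq_esum => c' _; rewrite ge0_integralZl_EFin//; last 3 first.
- by move=> x _; exact: flow_ge0.
- exact: measurable_flow.
- by rewrite mulr_ge0.
by rewrite ih -EFinM -mulrA kept_mass.
Qed.

Lemma integral_settled (P : probability T R) q : consistent L q -> forall j c,
  let p := level_mass P in
  \int[P]_x settled (kept p q) j c x = (matched L p q j c)%:E.
Proof.
move=> cq j c p; have cp : consistent L p := consistent_level_mass P.
have k01 := kept01 cp cq.
rewrite /settled ge0_integralZl_EFin//; last 3 first.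
- by move=> x _; exact: flow_ge0.
- exact: measurable_flow.
- by rewrite subr_ge0; case/andP: (k01 j c).
by rewrite integral_flow// -EFinM mulrBl mul1r kept_mass.
Qed.

Section matching.
Variables (dst : T -> T -> R) (D : nat -> R) (P Q : probability T R).
Hypothesis dst_ge0 : forall x y, (0 <= dst x y)%R.
Hypothesis mdst : measurable_fun setT (fun z : T * T => dst z.1 z.2).
Hypothesis D_ge0 : forall j, (0 <= D j)%R.
Hypothesis dstD : forall j c x y,
  phi j c x != 0%R -> phi j c y != 0%R -> (dst x y <= D j)%R.

Let p := level_mass P.
Let q := level_mass Q.
Let cp : consistent L p := consistent_level_mass P.
Let cq : consistent L q := consistent_level_mass Q.
Let U := unmatched p q.
(** Unmatched mass before level [j]; before level 0 this is the whole mass 1. *)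
Let U' j : R := if j is i.+1 then U i else 1%R.

Lemma settled_support u j c x : (forall j c, 0 <= u j c <= 1)%R ->
  settled u j c x != 0 -> phi j c x != 0%R.
Proof.
move=> u01; apply: contraNN => /eqP phi0.
have := flow_le u01 j c x; rewrite phi0 => f0.
have -> : settled u j c x = 0; last by [].
by rewrite /settled (_ : flow u j c x = 0) ?mule0//; apply/eqP;
  rewrite eq_le f0 flow_ge0.
Qed.

Lemma sum_unmatched_diff N :
  (\sum_(j < N) (U' j - U j) = 1 - U' N :> R)%R.
Proof.
elim: N => [|N ih]; first by rewrite big_ord0 subrr.
by rewrite big_ord_recr /= ih; case: N {ih} => [|N] /=; lra.
Qed.

(** Abel summation: the differences pass from the unmatched mass to the costs. *)
Lemma sum_cost_diff N :
  (\sum_(j < N.+1) D j * (U' j - U j) =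
   D 0 + \sum_(j < N) (D j.+1 - D j) * U j - D N * U N)%R.
Proof.
elim: N => [|N ih]; first by rewrite big_ord_recr !big_ord0 /=; lra.
by rewrite big_ord_recr /= ih big_ord_recr /=; lra.
Qed.

Lemma unmatched_nonincr j : (U' j - U j >= 0)%R.
Proof.
rewrite -lee_fin /U -(esum_matched L_ge0 L1 cp cq).
by apply: esum_ge0 => c _; rewrite lee_fin matched_ge0.
Qed.

(** The settled densities of [P] and [Q] are paired cell by cell, at cost at most [D j] on level
    [j]. Convergence of [U] to 0 means that all mass is eventually matched. *)
Lemma transport_cost_le_matching :
  (forall j, D j <= D j.+1)%R -> (U j @[j --> \oo] --> (0 : R))%R ->
  transport_cost dst P Q <=
  (D 0)%:E + \sum_(j <oo) ((D j.+1 - D j) * U j)%:E.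
Proof.
move=> D_nd U0.
have p01 := kept01 cp cq; have q01 := kept01 cq cp.
pose g k x := oapp (fun jc => settled (kept p q) jc.1 jc.2 x) 0
  (@pickle_inv (nat * I)%type k).
pose h k x := oapp (fun jc => settled (kept q p) jc.1 jc.2 x) 0
  (@pickle_inv (nat * I)%type k).
pose M k := oapp (fun jc => matched L p q jc.1 jc.2) 0%R (@pickle_inv (nat * I)%type k).
pose E k := oapp (fun jc : nat * I => D jc.1) 0%R (@pickle_inv (nat * I)%type k).
(* Used with [w = 1] for the total mass and with [w = D] for the cost. *)
have sum_M (w : nat -> R) : (forall j, 0 <= w j)%R ->
    \sum_(k <oo) oapp (fun jc => (w jc.1 * matched L p q jc.1 jc.2)%:E) 0
      (@pickle_inv (nat * I)%type k) =
    \sum_(j <oo) (w j * (U' j - U j))%:E.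
  move=> w0.
  have wM0 j c : 0 <= (w j * matched L p q j c)%:E.
    by rewrite lee_fin mulr_ge0 ?matched_ge0.
  rewrite -esumT_pickle_inv; last by move=> jc.
  rewrite -(pair_esum wM0) -nneseries_esumT; last first.
    by move=> j; exact: esum_ge0.
  apply: eq_eseriesr => j _; rewrite EFinM -(esum_matched L_ge0 L1 cp cq).
  rewrite -esumZl//; last by move=> c; rewrite lee_fin matched_ge0.
apply: (@le_trans _ _ (\sum_(k <oo) (E k * M k)%:E)).
  apply: (@transport_cost_le_pieces _ _ _ dst P Q _ _ g h) => //.
  - by move=> k x; rewrite /g; case: pickle_inv => //= jc; exact: settled_ge0.
  - by move=> k x; rewrite /h; case: pickle_inv => //= jc; exact: settled_ge0.
  - move=> k; rewrite /g; case: pickle_inv => [jc|] /=; last exact: measurable_cst.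
    exact: measurable_settled.
  - move=> k; rewrite /h; case: pickle_inv => [jc|] /=; last exact: measurable_cst.
    exact: measurable_settled.
  - move=> k; rewrite /g /M; case: pickle_inv => [jc|] /=; last exact: integral0.
    exact: integral_settled.
  - move=> k; rewrite /h /M; case: pickle_inv => [jc|] /=; last exact: integral0.
    by rewrite integral_settled// (matchedC L_ge0 cp cq).
  - by move=> k; rewrite /E; case: pickle_inv => /=.
  - move=> k x y; rewrite /g /h /E; case: pickle_inv => [jc|] /=; last by rewrite eqxx.
    move=> /(settled_support p01) px /(settled_support q01) py; exact: dstD px py.
  - move=> x; rewrite -esumT_pickle_inv; first exact: esum_settled_le1.
    by move=> jc; exact: settled_ge0.
  - move=> x; rewrite -esumT_pickle_inv; first exact: esum_settled_le1.
    by move=> jc; exact: settled_ge0.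
  - transitivity (\sum_(j <oo) (1 * (U' j - U j))%:E).
      rewrite -(sum_M (fun=> 1%R))//; apply: eq_eseriesr => k _.
      by rewrite /M; case: pickle_inv => //= jc; rewrite mul1r.
    apply/cvg_lim => //; rewrite -cvg_shiftS /=.
    rewrite (_ : (fun n => _) = fun n => (1 - U n)%:E).
      apply: cvg_EFin; first by near=> n.
      by rewrite -[X in _ --> X]subr0; apply: cvgB => //; exact: cvg_cst.
    apply/funext => n; under eq_bigr do rewrite mul1r.
    by rewrite big_mkord sumEFin sum_unmatched_diff.
rewrite (eq_eseriesr (g := fun k =>
  oapp (fun jc => (D jc.1 * matched L p q jc.1 jc.2)%:E) 0
  (@pickle_inv (nat * I)%type k))); last first.
  by move=> k _; rewrite /E /M; case: pickle_inv => //=; rewrite mulr0.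
rewrite sum_M//.
apply: lime_le.
  by apply: is_cvg_nneseries => j _ _; rewrite lee_fin mulr_ge0// unmatched_nonincr.
near=> N.
have [n ->] : exists n, N = n.+1 by exists N.-1; rewrite prednK//; near: N; exists 1%N.
rewrite big_mkord sumEFin sum_cost_diff.
(* The boundary term [D n * U n] enters with a minus sign and is dropped. *)
apply: (@le_trans _ _ (D 0 + \sum_(j < n) (D j.+1 - D j) * U j)%:E).
  by rewrite lee_fin gerBl mulr_ge0 ?unmatched_ge0.
rewrite EFinD leeD2l// -sumEFin
  -(big_mkord xpredT (fun j => ((D j.+1 - D j) * U j)%:E)).
apply: nneseries_lim_ge => j _ _; rewrite lee_fin mulr_ge0 ?unmatched_ge0// subr_ge0//.
Unshelve. all: by end_near.
Qed.

End matching.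
End flow.

(** * The quadratic B-spline *)

Section spline.
Context {R : realType}.
Implicit Types s t : R.

(* Quadratic rather than linear, because the square root must be Lipschitz. *)
Definition spline t : R :=
  if t <= 0 then 0 else if t <= 1 then t ^+ 2 / 2
  else if t <= 2 then 3 / 4 - (t - 3 / 2) ^+ 2
  else if t <= 3 then (3 - t) ^+ 2 / 2 else 0.

Lemma spline_le0 t : t <= 0 -> spline t = 0.
Proof. by rewrite /spline => ->. Qed.

Lemma spline_01 t : 0 <= t <= 1 -> spline t = t ^+ 2 / 2.
Proof.
move=> /andP[t0 t1]; rewrite /spline t1; case: ifPn => // h.
by have -> : t = 0; lra.
Qed.

Lemma spline_12 t : 1 <= t <= 2 -> spline t = 3 / 4 - (t - 3 / 2) ^+ 2.
Proof.
move=> /andP[t1 t2]; rewrite /spline t2 ifF; last by lra.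
by case: ifPn => // h; have -> : t = 1; lra.
Qed.

Lemma spline_23 t : 2 <= t <= 3 -> spline t = (3 - t) ^+ 2 / 2.
Proof.
move=> /andP[t1 t2]; rewrite /spline t2 ifF; last by lra.
rewrite ifF; last by lra.
by case: ifPn => // h; have -> : t = 2; lra.
Qed.

Lemma spline_ge3 t : 3 <= t -> spline t = 0.
Proof.
move=> t3; rewrite /spline ifF; last by lra.
rewrite ifF; last by lra.
rewrite ifF; last by lra.
by case: ifPn => // h; have -> : t = 3; lra.
Qed.

Lemma spline_ge0 t : 0 <= spline t.
Proof.
have [t0|t0] := leP t 0; first by rewrite spline_le0.
have [t1|t1] := leP t 1; first by rewrite spline_01; nra.
have [t2|t2] := leP t 2; first by rewrite spline_12; nra.
have [t3|t3] := leP t 3; first by rewrite spline_23; nra.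
by rewrite spline_ge3// ltW.
Qed.

Lemma spline_neq0 t : spline t != 0 -> 0 < t < 3.
Proof.
move=> tn0; apply/andP; split; rewrite ltNge; apply: contra tn0 => h.
  by rewrite spline_le0.
by rewrite spline_ge3.
Qed.

Lemma spline_partition t : 0 <= t <= 1 ->
  spline t + spline (t + 1) + spline (t + 2) = 1.
Proof.
move=> t01; rewrite spline_01// spline_12; last by lra.
by rewrite spline_23; [lra|lra].
Qed.

(** Two-scale relation with binomial weights 1, 3, 3, 1 over 4; on each unit interval from 0 to 6 it
    is a polynomial identity. *)
Lemma spline_refine t :
  spline (t / 2) = 1 / 4 * spline t + 3 / 4 * spline (t - 1) +
                   3 / 4 * spline (t - 2) + 1 / 4 * spline (t - 3).
Proof.
have [t0|t0] := leP t 0.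
  by rewrite !spline_le0; [lra|lra..].
have [t1|t1] := leP t 1.
  rewrite [spline (t / 2)]spline_01; last by lra.
  rewrite [spline t]spline_01; last by lra.
  by rewrite !spline_le0; [lra|lra..].
have [t2|t2] := leP t 2.
  rewrite [spline (t / 2)]spline_01; last by lra.
  rewrite [spline t]spline_12; last by lra.
  rewrite [spline (t - 1)]spline_01; last by lra.
  by rewrite !spline_le0; [lra|lra..].
have [t3|t3] := leP t 3.
  rewrite [spline (t / 2)]spline_12; last by lra.
  rewrite [spline t]spline_23; last by lra.
  rewrite [spline (t - 1)]spline_12; last by lra.
  rewrite [spline (t - 2)]spline_01; last by lra.
  by rewrite !spline_le0; [lra|lra..].
have [t4|t4] := leP t 4.
  rewrite [spline (t / 2)]spline_12; last by lra.
  rewrite [spline t]spline_ge3; last by lra.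
  rewrite [spline (t - 1)]spline_23; last by lra.
  rewrite [spline (t - 2)]spline_12; last by lra.
  by rewrite spline_01; [lra|lra..].
have [t5|t5] := leP t 5.
  rewrite [spline (t / 2)]spline_23; last by lra.
  rewrite [spline t]spline_ge3; last by lra.
  rewrite [spline (t - 1)]spline_ge3; last by lra.
  rewrite [spline (t - 2)]spline_23; last by lra.
  by rewrite spline_12; [lra|lra..].
have [t6|t6] := leP t 6.
  rewrite [spline (t / 2)]spline_23; last by lra.
  rewrite [spline t]spline_ge3; last by lra.
  rewrite [spline (t - 1)]spline_ge3; last by lra.
  rewrite [spline (t - 2)]spline_ge3; last by lra.
  by rewrite spline_23; [lra|lra..].
by rewrite !spline_ge3; [lra|lra..].
Qed.

Definition root_spline t : R := Num.sqrt (spline t).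

Lemma root_spline_sqr t : root_spline t ^+ 2 = spline t.
Proof. by rewrite sqr_sqrtr ?spline_ge0. Qed.

Lemma root_spline_ge0 t : 0 <= root_spline t.
Proof. exact: sqrtr_ge0. Qed.

(** Slope of [root_spline] on [[0, 1]], where it is linear. *)
Let K : R := Num.sqrt (1 / 2).
Let K0 : 0 < K. Proof. by rewrite sqrtr_gt0; lra. Qed.
Let K2 : K ^+ 2 = 1 / 2. Proof. by rewrite sqr_sqrtr//; lra. Qed.

Let lip_on (A : R -> bool) := forall s t, A s -> A t -> s <= t ->
  `|root_spline s - root_spline t| <= K * (t - s).

Let lip_glue (B C : R -> bool) (m : R) : B m ->
  (forall t, m <= t -> C t -> B t) ->
  lip_on (fun u => u <= m) -> lip_on B -> lip_on C.
Proof.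
move=> Bm CB lA lB s t Cs Ct st.
have [tm|mt] := leP t m; first by apply: lA => //; exact: le_trans tm.
have [ms|sm] := leP m s.
  by apply: lB => //; apply: CB => //; exact: ltW.
rewrite -(subrK (root_spline m) (root_spline s)) -addrA (le_trans (ler_normD _ _))//.
have := lA s m (ltW sm) (lexx m) (ltW sm).
by have := lB m t Bm (CB t (ltW mt) Ct) (ltW mt); lra.
Qed.

(** The outer pieces are linear of slope [K] and [- K]. On the middle piece [spline] is 1-Lipschitz
    and its root is at least [K], so dividing a difference of squares by a sum of at least [2 * K]
    gives the constant [1 / (2 * K) = K]. The pieces are then glued at 0, 1, 2 and 3. *)
Lemma root_spline_lipschitz s t :
  (root_spline s - root_spline t) ^+ 2 <= (s - t) ^+ 2 / 2.
Proof.
have k0 : 0 < K := K0; have k2 : K ^+ 2 = 1 / 2 := K2.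
have r01 u : 0 <= u <= 1 -> root_spline u = K * u.
  move=> u01; rewrite /root_spline spline_01// -[RHS]ger0_norm;
    last by rewrite mulr_ge0 ?(ltW k0)//; lra.
  by rewrite -sqrtr_sqr; congr Num.sqrt; rewrite exprMn K2; lra.
have r23 u : 2 <= u <= 3 -> root_spline u = K * (3 - u).
  move=> u01; rewrite /root_spline spline_23// -[RHS]ger0_norm;
    last by rewrite mulr_ge0 ?(ltW k0)//; lra.
  by rewrite -sqrtr_sqr; congr Num.sqrt; rewrite exprMn K2; lra.
have r12 u : 1 <= u <= 2 -> K <= root_spline u.
  by move=> u12; rewrite ler_sqrt ?spline_ge0// spline_12//; nra.
have l0 : lip_on (fun u => u <= 0).
  move=> u v u0 v0 uv; rewrite /root_spline !spline_le0// subrr normr0.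
  by rewrite mulr_ge0 ?subr_ge0// ltW.
have l1 : lip_on (fun u => 0 <= u <= 1).
  by move=> u v u0 v0 uv; rewrite !r01// -mulrBr ler0_norm; nra.
have l2 : lip_on (fun u => 1 <= u <= 2).
  move=> u v u12 v12 uv.
  have := r12 u u12; have := r12 v v12.
  have : root_spline u ^+ 2 - root_spline v ^+ 2 = (v - u) * (u + v - 3).
    by rewrite !root_spline_sqr !spline_12//; lra.
  move: (root_spline u) (root_spline v) => a b ab Ka Kb.
  have : `|a - b| * (a + b) <= v - u.
    rewrite -[X in _ * X]ger0_norm; last by lra.
    rewrite -normrM (_ : (a - b) * (a + b) = (v - u) * (u + v - 3));
      last by rewrite -ab; ring.
    rewrite normrM [`|v - u|]ger0_norm; last by lra.
    rewrite ler_piMr; [by []|lra|].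
    by rewrite ler_norml; lra.
  have := normr_ge0 (a - b); move: `|a - b| => z z0 zab.
  have : z * (2 * K) <= v - u by nra.
  by move: K2; rewrite expr2; nra.
have l3 : lip_on (fun u => 2 <= u <= 3).
  by move=> u v u0 v0 uv; rewrite !r23// -mulrBr ger0_norm; nra.
have l4 : lip_on (fun u => 3 <= u).
  move=> u v u0 v0 uv; rewrite /root_spline !spline_ge3// subrr normr0.
  by rewrite mulr_ge0 ?subr_ge0// ltW.
have m1 : lip_on (fun u => u <= 1) by apply: lip_glue l0 l1 => /= [|u]; lra.
have m2 : lip_on (fun u => u <= 2) by apply: lip_glue m1 l2 => /= [|u]; lra.
have m3 : lip_on (fun u => u <= 3) by apply: lip_glue m2 l3 => /= [|u]; lra.
have m4 : lip_on (fun u => true) by apply: lip_glue m3 l4.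
wlog st : s t / s <= t.
  by move=> h; have [/h//|/ltW/h{}h] := leP s t; lra.
have := m4 s t isT isT st.
rewrite -(ler_pXn2r (n := 2)) ?nnegrE ?normr_ge0 ?mulr_ge0 ?subr_ge0 ?(ltW k0)//.
by rewrite real_normK ?num_real// exprMn K2 -(sqrrN (t - s)) opprB; lra.
Qed.

End spline.

(** * Tensor products of splines *)

Section window.
Context {R : realType} (n : nat).
Implicit Types (base : 'I_n -> int) (c : {ffun 'I_n -> int}).

(** Enumerates a window of [4 ^ n] cells, so that a sum over Z^n of a function supported there
    becomes finite. *)
Definition shift base (e : {ffun 'I_n -> 'I_4}) : {ffun 'I_n -> int} :=
  [ffun i => base i + (e i)%:Z].

Lemma shift_inj base : injective (shift base).
Proof.
move=> e e' /ffunP h; apply/ffunP => i; apply/val_inj.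
by have := h i; rewrite !ffunE => /addrI [].
Qed.

Lemma shiftP base c : (forall i, base i <= c i < base i + 4) ->
  exists e, c = shift base e.
Proof.
move=> h; exists [ffun i => inord `|c i - base i|%N]; apply/ffunP => i.
rewrite !ffunE; by move: (c i) (base i) (h i) => x y xy; rewrite inordK; lia.
Qed.

Lemma esum_window base (f : {ffun 'I_n -> int} -> \bar R) :
  (forall c, 0 <= f c)%E ->
  (forall c, f c != 0%E -> forall i, base i <= c i < base i + 4) ->
  (\esum_(c in [set: {ffun 'I_n -> int}]) f c = \sum_e f (shift base e))%E.
Proof.
move=> f0 fb; apply: esum_finType => //; first exact: shift_inj.
by move=> c /fb; exact: shiftP.
Qed.

Lemma sum_shift_prod base (F : 'I_n -> int -> R) :
  \sum_e \prod_i F i (shift base e i) = \prod_i \sum_(j < 4) F i (base i + j%:Z).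
Proof.
rewrite bigA_distr_bigA; apply: eq_bigr => e _; apply: eq_bigr => i _.
by rewrite ffunE.
Qed.

Lemma esum_prod base (F : 'I_n -> int -> R) :
  (forall i z, 0 <= F i z) ->
  (forall i z, F i z != 0 -> base i <= z < base i + 4) ->
  (\esum_(c in [set: {ffun 'I_n -> int}]) (\prod_i F i (c i))%:E =
   (\prod_i \sum_(j < 4) F i (base i + j%:Z))%:E)%E.
Proof.
move=> F0 Fb; rewrite (esum_window (base := base)).
- by rewrite sumEFin sum_shift_prod.
- by move=> c; rewrite lee_fin prodr_ge0.
move=> c /eqP cn0 i; apply: Fb; apply/eqP => Fi0; apply: cn0.
by rewrite (bigD1 i)//= Fi0 mul0r.
Qed.

End window.

Section cells.
Context {R : realType} (n : nat).
Local Notation Zn := {ffun 'I_n -> int}.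
Implicit Types (y z : 'I_n -> R) (c : Zn).

Definition cell y c : R := \prod_i spline (y i - (c i)%:~R).

Lemma cell_ge0 y c : 0 <= cell y c.
Proof. by apply: prodr_ge0 => i _; exact: spline_ge0. Qed.

Lemma cell_neq0 y c i : cell y c != 0 -> 0 < y i - (c i)%:~R < 3.
Proof.
by move=> /eqP h; apply: spline_neq0; apply/eqP => s0; apply: h;
  rewrite /cell (bigD1 i)//= s0 mul0r.
Qed.

Lemma spline_floor (t : R) (k : int) : spline (t - k%:~R) != 0 ->
  Num.floor t - 2 <= k <= Num.floor t.
Proof.
move=> /spline_neq0 /andP[h1 h2]; apply/andP; split; last by rewrite floor_ge_int; lra.
suff : Num.floor t < k + 3 by lia.
by rewrite floor_lt_int intrD; lra.
Qed.

(** Three terms form the partition of unity at the fractional part of [t]. The fourth vanishes: the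
    last one if [m] is the floor of [t], the first one otherwise. *)
Lemma sum_spline (t : R) (m : int) : Num.floor t - 1 <= m <= Num.floor t ->
  \sum_(j < 4) spline (t - (m - 2 + j%:Z)%:~R) = 1.
Proof.
move=> mt; rewrite !big_ord_recr big_ord0 /= add0r.
have := floor_le_tmp t; have := floorD1_gt t.
set s := t - (Num.floor t)%:~R.
have : m = Num.floor t \/ m = Num.floor t - 1 by lia.
rewrite !(intrD, intrB) => -[->|->] h1 h2.
  rewrite [X in _ + X]spline_le0 ?addr0; last by lra.
  have s01 : 0 <= s <= 1 by rewrite /s; lra.
  transitivity (spline (s + 2) + spline (s + 1) + spline s).
    by congr (spline _ + spline _ + spline _); rewrite /s; lra.
  by have := spline_partition s01; lra.
rewrite spline_ge3 ?add0r; last by lra.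
have s01 : 0 <= s <= 1 by rewrite /s; lra.
transitivity (spline (s + 2) + spline (s + 1) + spline s).
  by congr (spline _ + spline _ + spline _); rewrite /s; lra.
by have := spline_partition s01; lra.
Qed.

(* The four indices from [base i] on contain the support of the splines at [y i];
   the slack of one lets a single window serve two nearby points. *)
Definition near_floor y (base : 'I_n -> int) :=
  forall i, Num.floor (y i) - 3 <= base i <= Num.floor (y i) - 2.

Lemma sum_cell y base : near_floor y base -> \sum_e cell y (shift base e) = 1.
Proof.
move=> yb; rewrite (sum_shift_prod base (fun i k => spline (y i - k%:~R))).
rewrite big1// => i _; rewrite -[RHS](@sum_spline (y i) (base i + 2));
  last by have := yb i; lia.
by apply: eq_bigr => j _; rewrite addrK.
Qed.

Lemma cell_near_floor y base c : near_floor y base -> cell y c != 0 ->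
  forall i, base i <= c i < base i + 4.
Proof.
move=> yb cn0 i; have := yb i.
have : Num.floor (y i) - 2 <= c i <= Num.floor (y i); last by lia.
apply: spline_floor; apply/eqP => s0; move/eqP: cn0; apply.
by rewrite /cell (bigD1 i)//= s0 mul0r.
Qed.

Lemma esum_cell y : (\esum_(c in [set: Zn]) (cell y c)%:E = 1)%E.
Proof.
have yb : near_floor y (fun i => Num.floor (y i) - 2) by move=> i; lia.
rewrite (esum_window (base := fun i => Num.floor (y i) - 2)).
- by rewrite sumEFin sum_cell.
- by move=> c; rewrite lee_fin cell_ge0.
- by move=> c cn0; apply: (cell_near_floor yb).
Qed.

(** The coefficients of [spline_refine]. *)
Definition mask (k : int) : R :=
  if (k == 0) || (k == 3) then 1 / 4 else if (k == 1) || (k == 2) then 3 / 4 else 0.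

Lemma mask_ge0 k : 0 <= mask k.
Proof. by rewrite /mask; case: ifP => _; [lra|case: ifP => _; lra]. Qed.

Lemma mask_neq0 k : mask k != 0 -> 0 <= k < 4.
Proof.
rewrite /mask; case: ifP => [|_]; first by lia.
by case: ifP => [|_]; [lia|rewrite eqxx].
Qed.

Definition coarsen c c' : R := \prod_i mask (c i - 2 * c' i).

Lemma coarsen_ge0 c c' : 0 <= coarsen c c'.
Proof. by apply: prodr_ge0 => i _; exact: mask_ge0. Qed.

(** In each coordinate an even index meets the mask at 0 and 2, an odd one at 1 and 3; both pairs of
    weights add up to 1. *)
Lemma esum_coarsen c : (\esum_(c' in [set: Zn]) (coarsen c c')%:E = 1)%E.
Proof.
rewrite (@esum_prod _ _ (fun i => (c i %/ 2)%Z - 1) (fun i k => mask (c i - 2 * k))).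
- rewrite big1// => i _; rewrite !big_ord_recr big_ord0 /= add0r.
  have : (c i = 2 * (c i %/ 2)%Z \/ c i = 2 * (c i %/ 2)%Z + 1) by lia.
  set h := (c i %/ 2)%Z; rewrite /mask => -[->|->].
  + rewrite (_ : 2 * h - 2 * (h - 1 + 0) = 2); last by lia.
    rewrite (_ : 2 * h - 2 * (h - 1 + 1) = 0); last by lia.
    rewrite (_ : 2 * h - 2 * (h - 1 + 2) = - 2); last by lia.
    rewrite (_ : 2 * h - 2 * (h - 1 + 3) = - 4); last by lia.
    rewrite /=; lra.
  + rewrite (_ : 2 * h + 1 - 2 * (h - 1 + 0) = 3); last by lia.
    rewrite (_ : 2 * h + 1 - 2 * (h - 1 + 1) = 1); last by lia.
    rewrite (_ : 2 * h + 1 - 2 * (h - 1 + 2) = - 1); last by lia.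
    rewrite (_ : 2 * h + 1 - 2 * (h - 1 + 3) = - 3); last by lia.
    rewrite /=; lra.
- by move=> i k; exact: mask_ge0.
- by move=> i k /mask_neq0; lia.
Qed.

Lemma esum_coarsen_cell y c' :
  (\esum_(c in [set: Zn]) (coarsen c c' * cell y c)%:E =
   (cell (fun i => y i / 2) c')%:E)%E.
Proof.
under eq_esum do rewrite /coarsen /cell -big_split /=.
rewrite (@esum_prod _ _ (fun i => 2 * c' i) (fun i k => mask (k - 2 * c' i) *
  spline (y i - k%:~R))).
- congr _%:E; apply: eq_bigr => i _; rewrite !big_ord_recr big_ord0 /= add0r.
  rewrite (_ : y i / 2 - (c' i)%:~R = (y i - 2 * (c' i)%:~R) / 2); last by lra.
  rewrite spline_refine /mask.
  rewrite (_ : 2 * c' i + 0 - 2 * c' i = 0); last by lia.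
  rewrite (_ : 2 * c' i + 1 - 2 * c' i = 1); last by lia.
  rewrite (_ : 2 * c' i + 2 - 2 * c' i = 2); last by lia.
  rewrite (_ : 2 * c' i + 3 - 2 * c' i = 3); last by lia.
  rewrite /= !intrD !intrM addr0.
  by congr (_ * spline _ + _ * spline _ + _ * spline _ + _ * spline _); lra.
- by move=> i k; rewrite mulr_ge0 ?mask_ge0 ?spline_ge0.
- move=> i k h; have /mask_neq0 : mask (k - 2 * c' i) != 0.
    by apply: contra h => /eqP ->; rewrite mul0r.
  by lia.
Qed.

End cells.

(** Weierstrass product inequality; the induction carries along the upper bound 1 on the product. *)
Lemma prod_onem_ge (R : realDomainType) (I : finType) (t : I -> R) :
  (forall i, 0 <= t i <= 1) -> 1 - \sum_i t i <= \prod_i (1 - t i).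
Proof.
move=> t01.
suff : 1 - \sum_i t i <= \prod_i (1 - t i) /\ \prod_i (1 - t i) <= 1 /\ 0 <= \sum_i
  t i by case.
apply: (big_rec2 (fun x y => 1 - x <= y /\ y <= 1 /\ 0 <= x)); first by lra.
by move=> i x y _ [? [? ?]]; have /andP[? ?] := t01 i; split; [|split]; nra.
Qed.

(** * Dimension-free continuity of the cell weights *)

Section cell_distance.
Context {R : realType} (n : nat).
Local Notation Zn := {ffun 'I_n -> int}.
Implicit Types (y z : 'I_n -> R) (c : Zn).

Lemma cell_dist_le2 y z :
  (\esum_(c in [set: Zn]) `|cell y c - cell z c|%:E <= 2%:E)%E.
Proof.
rewrite (_ : 2 = 1 + 1)%R // EFinD -[X in (X + _)%E](esum_cell y) -(esum_cell z).
rewrite -esumD => [|c _|c _]; rewrite ?lee_fin ?cell_ge0//.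
apply: le_esum => c _; rewrite -EFinD lee_fin.
by rewrite (le_trans (ler_normB _ _))// !ger0_norm ?cell_ge0.
Qed.

(** Floors of points less than 1 apart differ by at most one, so a window based at the smaller point
    serves both. *)
Lemma floor_min_near (s t : R) : `|s - t| < 1 ->
  Num.floor s - 1 <= Num.floor (Num.min s t) <= Num.floor s /\
  Num.floor t - 1 <= Num.floor (Num.min s t) <= Num.floor t.
Proof.
have h1 := floor_le_tmp s; have h2 := floorD1_gt s.
have h3 := floor_le_tmp t; have h4 := floorD1_gt t.
rewrite ltr_norml => /andP[st1 st2].
have [st|st] := leP s t.
  have : Num.floor s <= Num.floor t by exact: le_floor.
  suff : Num.floor t < Num.floor s + 2 by lia.
  by rewrite floor_lt_int; move: h2; rewrite !intrD; lra.
have : Num.floor t <= Num.floor s by apply: le_floor; exact: ltW.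
suff : Num.floor s < Num.floor t + 2 by lia.
by rewrite floor_lt_int; move: h4; rewrite !intrD; lra.
Qed.

(* The Hellinger affinity, unlike the L1 distance, is multiplicative over the
   coordinates, which makes the resulting bound dimension-free. *)
Lemma affinity_ge (s t : R) (m : int) : `|s - t| < 1 ->
  Num.floor (Num.min s t) = m ->
  1 - (s - t) ^+ 2 <=
  \sum_(j < 4) root_spline (s - (m - 2 + j%:Z)%:~R) *
    root_spline (t - (m - 2 + j%:Z)%:~R).
Proof.
move=> st1 fm.
have fs := floor_min_near st1; rewrite fm in fs.
have := sum_spline fs.1; have := sum_spline fs.2.
set A := \sum_(j < 4) _ => A1; set B := \sum_(j < 4) _ => B1; set C := \sum_(j < 4) _.
(* Here [A = B = 1], and [A + B - 2 * C] is a sum of four squared differences of roots, each at most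
   half of [(s - t) ^+ 2]. *)
suff : A + B - 2 * C <= 2 * (s - t) ^+ 2 by lra.
rewrite /A /B /C mulr_sumr -big_split /= -sumrB /=.
apply: (@le_trans _ _ (\sum_(j < 4) (s - t) ^+ 2 / 2)).
  apply: ler_sum => j _; rewrite -!root_spline_sqr.
  set c := (_)%:~R.
  have := root_spline_lipschitz (s - c) (t - c).
  rewrite (_ : s - c - (t - c) = s - t); last by lra.
  by move: (root_spline _) (root_spline _) => a b; lra.
by rewrite sumr_const card_ord -mulr_natl; lra.
Qed.

(** For [delta >= 1] the trivial bound 2 is enough. Otherwise the affinity [BC] is at least
    [1 - delta ^+ 2], and a weighted arithmetic-geometric mean inequality turns this into an l1
    bound. *)
Lemma cell_dist_le y z (delta : R) : 0 <= delta ->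
  \sum_i (y i - z i) ^+ 2 <= delta ^+ 2 ->
  (\esum_(c in [set: Zn]) `|cell y c - cell z c|%:E <= (2 * Num.sqrt 2 * delta)%:E)%E.
Proof.
move=> d0 yz.
have yzi i : (y i - z i) ^+ 2 <= delta ^+ 2.
  by apply: le_trans yz; rewrite (bigD1 i)//= lerDl sumr_ge0// => j _; exact: sqr_ge0.
have s2 : 1 <= Num.sqrt 2 :> R by rewrite -{1}sqrtr1 ler_sqrt//; lra.
have s22 : Num.sqrt 2 ^+ 2 = 2 :> R by rewrite sqr_sqrtr.
have [d1|d1] := leP 1 delta.
  by apply: (le_trans (cell_dist_le2 y z)); rewrite lee_fin; nra.
have [de0|dn0] := eqVneq delta 0.
  rewrite esum1 ?de0 ?mulr0// => c _;
    rewrite (_ : cell y c = cell z c) ?subrr ?normr0//.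
  apply: eq_bigr => i _; congr (spline (_ - _)).
  have := yzi i; rewrite de0 expr0n /= => h.
  by apply/eqP; rewrite -subr_eq0 -sqrf_eq0 eq_le h sqr_ge0.
have yz1 i : `|y i - z i| < 1.
  have := yzi i; rewrite -real_normK ?num_real// => h.
  have h0 := normr_ge0 (y i - z i); nra.
pose base i := Num.floor (Num.min (y i) (z i)) - 2.
have nf : near_floor y base /\ near_floor z base.
  by split=> i; have [] := floor_min_near (yz1 i); rewrite /base; clear; lia.
rewrite (esum_window (base := base)); last 2 first.
- by move=> c; rewrite lee_fin.
- move=> c cn0.
  have [c0|c0] := eqVneq (cell y c) 0; last exact: (cell_near_floor nf.1).
  apply: (cell_near_floor nf.2); apply: contra cn0 => /eqP c0'.
  by rewrite c0 c0' subrr normr0.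
rewrite sumEFin lee_fin.
pose rc y c : R := \prod_i root_spline (y i - (c i)%:~R).
have rc0 w c : 0 <= rc w c by apply: prodr_ge0 => i _; exact: root_spline_ge0.
have rcE w c : cell w c = rc w c ^+ 2.
  by rewrite expr2 -big_split /=; apply: eq_bigr => i _; rewrite -root_spline_sqr expr2.
set BC := \sum_e rc y (shift base e) * rc z (shift base e).
have BC1 : 1 - delta ^+ 2 <= BC.
  rewrite /BC; under eq_bigr do rewrite -big_split /=.
  rewrite (sum_shift_prod base (fun i k => root_spline (y i - k%:~R) * root_spline
    (z i - k%:~R))).
  apply: (@le_trans _ _ (1 - \sum_i (y i - z i) ^+ 2)); first by lra.
  have t01 i : 0 <= (y i - z i) ^+ 2 <= 1.
    by rewrite sqr_ge0 (le_trans (yzi i))//; nra.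
  apply: (le_trans (prod_onem_ge t01)); apply: ler_prod => i _.
  rewrite subr_ge0; have /andP[_ ->] := t01 i => /=.
  exact: affinity_ge.
(* With [delta ^+ 2 = 2 * eps ^+ 2], the final inequality reads [eps * S <= 1 + eps ^+ 2 - (1 - eps
   ^+ 2) * (1 - 2 * eps ^+ 2)], which is at most [4 * eps ^+ 2]. *)
pose eps := delta / Num.sqrt 2.
have e0 : 0 < eps by rewrite divr_gt0//; lra.
have e1 : eps <= 1 by rewrite ler_pdivrMr; lra.
have dE : delta = Num.sqrt 2 * eps by rewrite /eps mulrC divfK//; lra.
(* With [a], [b] the two roots and [w] the distance between them, this expands [2 * w * eps * (a +
   b) <= w ^+ 2 + eps ^+ 2 * (a + b) ^+ 2]. *)
have pw e : eps * `|cell y (shift base e) - cell z (shift base e)| +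
    (1 - eps ^+ 2) * (rc y (shift base e) * rc z (shift base e)) <=
    (1 + eps ^+ 2) / 2 * (cell y (shift base e) + cell z (shift base e)).
  rewrite !rcE; have := rc0 z (shift base e); have := rc0 y (shift base e).
  move: (rc y _) (rc z _) => a b a0 b0.
  rewrite subr_sqr normrM [`|a + b|]ger0_norm ?addr_ge0//.
  have := sqr_ge0 (`|a - b| - eps * (a + b)); rewrite sqrrB real_normK ?num_real//.
  move: `|a - b| => w; nra.
have : eps * \sum_e `|cell y (shift base e) - cell z (shift base e)| + (1 - eps ^+
  2) * BC <=
       (1 + eps ^+ 2).
  rewrite [leRHS](_ : _ = (1 + eps ^+ 2) / 2 * (\sum_e cell y (shift base e) +
    \sum_e cell z (shift base e))).
    by rewrite /BC !mulr_sumr -!big_split /= mulr_sumr; apply: ler_sum => e _;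
      exact: pw.
  by rewrite (sum_cell nf.1) (sum_cell nf.2); lra.
move: (\sum_e _) => S hS.
rewrite (_ : 2 * Num.sqrt 2 * delta = 4 * eps); last first.
  by rewrite dE mulrA -(mulrA 2) -expr2 s22; lra.
have : eps * S <= eps * (4 * eps).
  move: BC1; rewrite dE exprMn s22 => BC1.
  have e2 : 0 <= 1 - eps ^+ 2 by nra.
  have : (1 - eps ^+ 2) * (1 - 2 * eps ^+ 2) <= (1 - eps ^+ 2) * BC.
    by rewrite ler_wpM2l.
  nra.
by rewrite ler_pM2l.
Qed.

End cell_distance.

(** * Sums over dyadic levels *)

Section levels.
Context {R : realType}.

Lemma esum_geometric (a s : R) : 0 <= a -> 0 <= s < 1 ->
  (\esum_(j in [set: nat]) (a * s ^+ j)%:E = (a / (1 - s))%:E)%E.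
Proof.
move=> a0 /andP[s0 s1].
rewrite -nneseries_esumT; last by move=> j; rewrite lee_fin mulr_ge0// exprn_ge0.
apply/cvg_lim => //.
rewrite (_ : (fun n => _) = EFin \o series (geometric a s)); last first.
  by apply/funext => N /=; rewrite sumEFin.
apply: cvg_EFin; first by near=> N.
by apply: cvg_geometric_series; rewrite ger0_norm.
Unshelve. all: by end_near.
Qed.

Lemma esum_int_split (m : int) (f : int -> \bar R) : (forall k, 0 <= f k)%E ->
  (\esum_(k in [set: int]) f k =
   \esum_(j in [set: nat]) f (m - j%:Z)%R +
   \esum_(j in [set: nat]) f (m + 1 + j%:Z)%R)%E.
Proof.
move=> f0; rewrite (esumID [set k | k <= m])//; congr (_ + _)%E; rewrite setTI.
  apply: (reindex_esum [set: nat] _ (fun j => m - j%:Z)); split=> [j _|i j _ _|k].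
  - by rewrite /=; lia.
  - by rewrite /=; lia.
  - by move=> /= km; exists `|m - k|%N => //; lia.
apply: (reindex_esum [set: nat] _ (fun j => m + 1 + j%:Z)); split=> [j _|i j _ _|k].
- by rewrite /=; lia.
- by rewrite /=; lia.
- by move=> /= km; exists (absz (k - (m + 1))%R) => //; lia.
Qed.

Definition scale (k : int) : R := 2 `^ k%:~R.

Lemma scale_gt0 k : 0 < scale k.
Proof. by rewrite powR_gt0. Qed.

Lemma scaleD1 k : scale (k + 1) = 2 * scale k.
Proof. by rewrite /scale intrD powRD ?pnatr_eq0 ?implybT// mulr1z powRr1// mulrC. Qed.

Lemma scale_powR k (q : R) : scale k `^ q = 2 `^ (k%:~R * q).
Proof. by rewrite powRrM. Qed.

Lemma log2_floor (A : R) : 0 < A -> exists m : int, scale m <= A /\ A <= scale (m + 1).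
Proof.
move=> A0; pose l := ln A / ln 2.
have ln2 : 0 < ln (2 : R) by rewrite ln_gt0// ltr1n.
have AE : A = 2 `^ l.
  by rewrite /powR (negbTE (lt0r_neq0 _))// /l divfK ?gt_eqF// lnK.
exists (Num.floor l); rewrite AE /scale; split; apply: ler_powR; rewrite ?ler1n//.
- exact: floor_le_tmp.
- exact/ltW/floorD1_gt.
Qed.

(** Two geometric series, for the levels below and above a given length. *)
Definition level_const (q : R) : R := 1 / (1 - 2 `^ (- q)) + 1 / (1 - 2 `^ (q - 1)).

Lemma two_powR_lt1 (r : R) : r < 0 -> 2 `^ r < 1.
Proof.
move=> r0; rewrite -[ltRHS](powRr0 2) /powR; case: ifP => [/eqP|_]; first by lra.
by rewrite ltr_expR mul0r nmulr_rlt0// ln_gt0// ltr1n.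
Qed.

Lemma two_powR_gt1 (r : R) : 0 < r -> 1 < 2 `^ r.
Proof.
by move=> r0; rewrite -[r]opprK powRN invf_gt1 ?powR_gt0// two_powR_lt1// oppr_lt0.
Qed.

Lemma level_const_gt0 (q : R) : 0 < q < 1 -> 0 < level_const q.
Proof.
move=> /andP[q0 q1]; rewrite /level_const addr_gt0// divr_gt0// subr_gt0;
  by apply: two_powR_lt1; lra.
Qed.

(** Split at the dyadic level of [A]. Below it the minimum is bounded by 2, above it by the linear
    term, and either series decays geometrically away from [A]. *)
Lemma level_sum (A q : R) : 0 < q < 1 -> 0 <= A ->
  (\esum_(k in [set: int]) (scale k `^ q * Num.min 2 (2 * (A / scale k)))%:E
    <= (2 * A `^ q * level_const q)%:E)%E.
Proof.
move=> q01 A0; have C0 := ltW (level_const_gt0 q01).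
have /andP[q0 q1] := q01.
have s1 : 0 <= 2 `^ (- q) < 1 by rewrite powR_ge0 two_powR_lt1//; lra.
have w1 : 0 <= 2 `^ (q - 1) < 1 by rewrite powR_ge0 two_powR_lt1//; lra.
move: A0; rewrite le_eqVlt => /orP[/eqP <-|A0].
  rewrite esum1; first by rewrite lee_fin !mulr_ge0// powR_ge0.
  by move=> k _; rewrite mul0r mulr0 min_r// mulr0.
have [m [mA Am]] := log2_floor A0.
rewrite (esum_int_split m); last first.
  move=> k; rewrite lee_fin mulr_ge0 ?powR_ge0// le_min ler0n/=.
  by rewrite mulr_ge0// divr_ge0 ?ltW ?scale_gt0.
rewrite /level_const mulrDr EFinD.
have AQ : 0 <= 2 * A `^ q by rewrite mulr_ge0// powR_ge0.
rewrite !mulrA !mulr1 -!esum_geometric//.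
apply: leeD; apply: le_esum => j _; rewrite lee_fin.
- rewrite scale_powR (_ : (m - j%:Z)%:~R * q = m%:~R * q + - q * j%:R); last first.
    by rewrite intrB; ring.
  rewrite powRD ?pnatr_eq0 ?implybT// (powRrM 2 m%:~R) (powRrM 2 (- q)) powR_mulrn
    ?powR_ge0//.
  have sm : scale m `^ q <= A `^ q by rewrite ge0_ler_powR ?nnegrE ?powR_ge0//; lra.
  apply: (@le_trans _ _ (scale m `^ q * (2 `^ (- q)) ^+ j * 2)).
    by rewrite ler_wpM2l ?mulr_ge0 ?exprn_ge0 ?powR_ge0// ge_min lexx.
  by rewrite mulrC -(mulrA 2) ler_wpM2l// ler_wpM2r// exprn_ge0// powR_ge0.
- apply: (@le_trans _ _ (2 * A * scale (m + 1 + j%:Z) `^ (q - 1))).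
    rewrite powRB; last by rewrite (gt_eqF (scale_gt0 _)) implybT.
    rewrite powRr1; last by rewrite ltW// scale_gt0.
    apply: (@le_trans _ _
      (scale (m + 1 + j%:Z) `^ q * (2 * (A / scale (m + 1 + j%:Z))))).
      by rewrite ler_wpM2l ?powR_ge0// ge_min lexx orbT.
    by rewrite le_eqVlt; apply/orP; left; apply/eqP; ring.
  rewrite scale_powR (_ : (m + 1 + j%:Z)%:~R * (q - 1) = (m + 1)%:~R * (q - 1) + (q
    - 1) * j%:R); last first.
    by rewrite [in LHS]intrD; ring.
  rewrite [in leLHS]powRD ?pnatr_eq0 ?implybT// (powRrM 2 (m + 1)%:~R) (powRrM 2 (q
    - 1)) powR_mulrn ?powR_ge0//.
  rewrite mulrA ler_wpM2r ?exprn_ge0 ?powR_ge0//.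
  rewrite -mulrA ler_wpM2l// -(mulr_powRB1 (ltW A0) q0) ler_wpM2l ?(ltW A0)//.
  (* As [q - 1] is negative, [A <= scale (m + 1)] yields the bound after inversion. *)
  rewrite -/(scale (m + 1)) -(opprB 1 q) !powRN.
  rewrite lef_pV2 ?posrE ?powR_gt0 ?scale_gt0//.
  by rewrite ge0_ler_powR ?nnegrE ?(ltW (scale_gt0 _))//; lra.
Qed.

End levels.

(** * Embedding l1 into L1 *)

Section step_embedding.
Context {R : realType}.
Local Notation lam := (@completed_lebesgue_measure R).
Local Notation lebesgue_type := (caratheodory_type (wlength (@idfun R))^*%mu).

(* Piece [j.+1] carries the [j]-th coordinate; piece [0] is the null set [{0}]. *)
Definition piece (j : nat) : set R :=
  if j is i.+1 then [set` `](i.+2%:R)^-1, (i.+1%:R)^-1]%R] else [set 0].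

Definition piece_length (j : nat) : R := (j.+1%:R)^-1 - (j.+2%:R)^-1.

Lemma piece_length_gt0 j : 0 < piece_length j.
Proof. by rewrite subr_gt0 ltf_pV2 ?posrE ?ltr0n// ltr_nat. Qed.

(** Since [0^-1 = 0], the point 0 gets index 0, in agreement with [piece 0]. *)
Definition piece_index (t : R) : nat := Num.truncn t^-1.

Lemma piece_indexP j t : piece j t -> piece_index t = j.
Proof.
case: j => [/= ->|j /=]; first by rewrite /piece_index invr0 truncn0.
rewrite in_itv /= => /andP[jt tj]; apply: truncn_def.
have t0 : 0 < t by apply: lt_trans jt; rewrite invr_gt0 ltr0n.
rewrite -[j.+1%:R]invrK -[j.+2%:R]invrK lef_pV2 ?ltf_pV2 ?posrE ?invr_gt0 ?ltr0n//.
by rewrite tj jt.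
Qed.

Lemma piece_cover : \bigcup_j piece j = [set` `[0, 1]%R].
Proof.
apply/seteqP; split=> [t [j _]|t]; rewrite /= in_itv /=.
  case: j => [/= ->|j /=]; first by rewrite lexx ler01.
  rewrite in_itv /= => /andP[jt tj].
  rewrite ltW ?(lt_trans _ jt) ?invr_gt0 ?ltr0n//= (le_trans tj)//.
  by rewrite invf_le1 ?ltr0n// ler1n.
move=> /andP[]; rewrite le_eqVlt => /orP[/eqP <- _|t0 t1]; first by exists 0.
have : 1 <= t^-1 by rewrite -[leLHS]invr1 lef_pV2// posrE.
move=> it1; have /andP[h1 h2] := truncn_itv (le_trans ler01 it1).
exists (Num.truncn t^-1) => //.
have : (0 < Num.truncn t^-1)%N by rewrite truncn_gt0.
case: (Num.truncn t^-1) h1 h2 => // j h1 h2 _; rewrite /piece /= in_itv /=.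
rewrite -[X in _ < X]invrK -[X in X <= _]invrK.
by rewrite lef_pV2 ?ltf_pV2 ?posrE ?invr_gt0 ?ltr0n// h1 h2.
Qed.

Lemma trivIset_piece : trivIset setT piece.
Proof.
by move=> i j _ _ [t [/piece_indexP <- /piece_indexP <-]].
Qed.

Lemma measurable_piece j : measurable (piece j : set lebesgue_type).
Proof.
apply: sub_caratheodory; case: j => [|j]; first exact: measurable_set1.
exact: measurable_itv.
Qed.

Lemma lam_piece j : lam (piece j.+1) = (piece_length j)%:E.
Proof.
(* Both measures are restrictions of one outer measure, hence convertible. *)
rewrite -[LHS]/(@lebesgue_measure R (piece j.+1)) /piece lebesgue_measure_itv /=.
rewrite lte_fin ifT ?EFinB//.
by rewrite ltf_pV2 ?posrE ?ltr0n// ltr_nat.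
Qed.

(** Dividing by the length makes the integral over a piece equal to the coordinate. *)
Definition step (a : nat -> R) (t : R) : R :=
  if piece_index t is j.+1 then a j / piece_length j else 0.

Lemma step_piece a j t : piece j.+1 t -> step a t = a j / piece_length j.
Proof. by rewrite /step => /piece_indexP ->. Qed.

Lemma step0 a : step a 0 = 0.
Proof. by rewrite /step /piece_index invr0 truncn0. Qed.

Lemma measurable_step a : @measurable_fun _ _ lebesgue_type R [set` `[0%R, 1%R]]
  (step a).
Proof.
rewrite -piece_cover; apply/measurable_fun_bigcup; first exact: measurable_piece.
case=> [|j].
  apply: (@eq_measurable_fun _ _ lebesgue_type R _ (cst 0)); last exact: measurable_cst.
  by move=> t; rewrite inE /= => ->; rewrite step0.
apply: (@eq_measurable_fun _ _ lebesgue_type R _ (cst (a j / piece_length j)));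
  last exact: measurable_cst.
by move=> t; rewrite inE => /step_piece ->.
Qed.

Lemma integral_step_dist (a b : nat -> R) :
  (\int[lam]_(t in `[0%R, 1%R]) `|step a t - step b t|%:E =
   \sum_(j <oo) `|a j - b j|%:E)%E.
Proof.
rewrite -piece_cover ge0_integral_bigcup; last first.
- exact: trivIset_piece.
- by move=> t _; rewrite lee_fin.
- have m1 : @measurable_fun _ _ lebesgue_type R (\bigcup_j piece j) (fun t => step
  a t - step b t).
    by rewrite piece_cover; apply: measurable_funB; exact: measurable_step.
  have m2 : @measurable_fun _ _ lebesgue_type R (\bigcup_j piece j) (fun t =>
    `|step a t - step b t|).
    by apply: measurableT_comp m1; exact: normr_measurable.
  exact/measurable_EFinP.
- exact: measurable_piece.
rewrite nneseries_recl//; last by move=> j _; exact: integral_ge0.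
rewrite [X in (X + _)%E](_ : _ = 0%E) ?add0e; last first.
  by apply: integral0_eq => t /= ->; rewrite !step0 subrr normr0.
rewrite -nneseries_addn; last by move=> j; exact: integral_ge0.
apply: eq_eseriesr => j _; rewrite addn1.
under eq_integral => t.
  rewrite inE => tj; rewrite !(step_piece _ tj) -mulrBl normrM; over.
rewrite integral_cst; last exact: measurable_piece.
rewrite [X in (_ * X)%E](lam_piece j) -EFinM [`|_^-1|]gtr0_norm ?invr_gt0
  ?piece_length_gt0//.
by rewrite divfK// gt_eqF// piece_length_gt0.
Qed.

Lemma integrable_step (a : nat -> R) : (\sum_(j <oo) `|a j|%:E < +oo)%E ->
  lam.-integrable `[0%R, 1%R] (EFin \o step a).
Proof.
move=> ao; apply/integrableP; split; first exact/measurable_EFinP/measurable_step.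
apply: le_lt_trans ao; rewrite le_eqVlt; apply/orP; left; apply/eqP.
transitivity (\int[lam]_(t in `[0%R, 1%R]) `|step a t - step (fun=> 0) t|%:E)%E.
  apply: eq_integral => t _; rewrite /= [X in _ - X](_ : _ = 0) ?subr0//.
  by rewrite /step; case: piece_index => // j; rewrite mul0r.
by rewrite integral_step_dist; apply: eq_eseriesr => j _; rewrite subr0.
Qed.

Definition L1_of_l1 (a : {a : nat -> R | (\sum_(j <oo) `|a j|%:E < +oo)%E}) : L1 R :=
  exist _ (step (sval a)) (integrable_step (svalP a)).

Lemma L1_of_l1_dist a b :
  L1_dist (L1_of_l1 a) (L1_of_l1 b) = (\sum_(j <oo) `|sval a j - sval b j|%:E)%E.
Proof. exact: integral_step_dist. Qed.

End step_embedding.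

(** * Cells in Euclidean space *)

Section measurable_bigop.
Context d (T : measurableType d) (R : realType) (I : finType).

Lemma measurable_fun_sum (D : set T) (f : I -> T -> R) :
  (forall i, measurable_fun D (f i)) -> measurable_fun D (fun x => \sum_i f i x).
Proof.
move=> mf; elim: (index_enum I) => [|i s ih].
  by under eq_fun do rewrite big_nil; exact: measurable_cst.
by under eq_fun do rewrite big_cons; exact: measurable_funD.
Qed.

Lemma measurable_fun_prod (D : set T) (f : I -> T -> R) :
  (forall i, measurable_fun D (f i)) -> measurable_fun D (fun x => \prod_i f i x).
Proof.
move=> mf; elim: (index_enum I) => [|i s ih].
  by under eq_fun do rewrite big_nil; exact: measurable_cst.
by under eq_fun do rewrite big_cons; exact: measurable_funM.
Qed.

End measurable_bigop.

Lemma measurable_spline (R : realType) : measurable_fun setT (@spline R).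
Proof.
have m (a : R) : measurable_fun setT (fun t : R => t <= a).
  by apply: measurable_fun_ler => //; exact: measurable_id.
apply: measurable_fun_ifT => //.
apply: measurable_fun_ifT => //.
  by apply: measurable_funM => //; apply: measurable_funX.
apply: measurable_fun_ifT => //.
  apply: measurable_funB => //; apply: measurable_funX; exact: measurable_funB.
apply: measurable_fun_ifT => //.
apply: measurable_funM => //; apply: measurable_funX; exact: measurable_funB.
Qed.

Section euclidean.
Context {R : realType} (n : nat).
Local Notation E := (borelRn R n).

Definition coord (i : 'I_n) (x : E) : R := (x : 'rV[R]_n) ord0 i.

Lemma measurable_coord i : measurable_fun setT (coord i).
Proof.
apply: (measurability _ (RGenOInfty.measurableE R)) => //.
move=> _ [_ [a ->] <-]; rewrite setTI.
apply: sub_sigma_algebra;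
  rewrite preimage_itvoy -[X in open X]/(coord i @^-1` [set r | a < r]).
apply: open_comp; last exact: open_gt.
by move=> x _; exact: coord_continuous.
Qed.

Definition bump (k : int) (c : {ffun 'I_n -> int}) (x : E) : R :=
  cell (fun i => coord i x / scale k) c.

Lemma measurable_bump k c : measurable_fun setT (bump k c).
Proof.
rewrite /bump /cell.
apply: measurable_fun_prod => i.
apply: (measurableT_comp (@measurable_spline R)).
apply: measurable_funB => //; apply: measurable_funM => //.
exact: measurable_coord.
Qed.

Lemma pow_dist_ge0 q (x y : E) : 0 <= pow_dist n q x y.
Proof. exact: powR_ge0. Qed.

Lemma measurable_pow_dist_comp q d (O : measurableType d) (X Y : O -> E) :
  measurable_fun setT X -> measurable_fun setT Y ->
  measurable_fun setT (fun w => pow_dist n q (X w) (Y w)).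
Proof.
move=> mX mY; apply: (measurableT_comp (measurable_powR _)).
apply: (measurableT_comp (continuous_measurable_fun (@sqrt_continuous R))).
apply: measurable_fun_sum => i; apply: measurable_funX.
rewrite (_ : (fun w => _) = fun w => coord i (X w) - coord i (Y w)); last first.
  by apply/funext => w; rewrite /coord !mxE.
by apply: measurable_funB; apply: measurableT_comp => //; exact: measurable_coord.
Qed.

Lemma sum_sqr_coord k (x y : E) :
  \sum_i (coord i x / scale k - coord i y / scale k) ^+ 2 =
  (norm2 ((x : 'rV[R]_n) - y) / scale k) ^+ 2.
Proof.
rewrite exprMn sqr_sqrtr; last by apply: sumr_ge0 => i _; exact: sqr_ge0.
rewrite mulr_suml; apply: eq_bigr => i _.
by rewrite /coord -mulrBl exprMn !mxE.
Qed.

Lemma bump_dist_le k (x y : E) :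
  (\esum_(c in [set: {ffun 'I_n -> int}]) `|bump k c x - bump k c y|%:E <=
   (Num.min 2 (2 * (Num.sqrt 2 * norm2 ((x : 'rV[R]_n) - y) / scale k)))%:E)%E.
Proof.
rewrite EFin_min le_min cell_dist_le2 /=.
rewrite mulrA mulrA -mulrA; apply: cell_dist_le; last by rewrite sum_sqr_coord.
by rewrite divr_ge0 ?sqrtr_ge0 ?ltW ?scale_gt0.
Qed.

(** Comes from [level_sum] with [A] equal to [sqrt 2] times the Euclidean distance. *)
Definition upper_const (q : R) : R := 2 * Num.sqrt 2 `^ q * level_const q.

Lemma bump_pow_dist (q : R) (x y : E) : 0 < q < 1 ->
  (\esum_(kc in [set: int * {ffun 'I_n -> int}])
     (scale kc.1 `^ q * `|bump kc.1 kc.2 x - bump kc.1 kc.2 y|)%:E <=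
   (upper_const q * pow_dist n q x y)%:E)%E.
Proof.
move=> q01.
rewrite -(@pair_esum R int _ (fun k c => (scale k `^ q * `|bump k c x - bump k c
  y|)%:E)); last first.
  by move=> k c; rewrite lee_fin mulr_ge0 ?powR_ge0.
have A0 : 0 <= Num.sqrt 2 * norm2 ((x : 'rV[R]_n) - y) by rewrite mulr_ge0 ?sqrtr_ge0.
apply: le_trans (le_trans (level_sum q01 A0) _).
  apply: le_esum => k _; under eq_esum do rewrite EFinM.
  rewrite esumZl ?powR_ge0// EFinM lee_wpmul2l ?lee_fin ?powR_ge0//.
  exact: bump_dist_le.
rewrite lee_fin powRM ?sqrtr_ge0// /upper_const /pow_dist.
by rewrite le_eqVlt; apply/orP; left; apply/eqP; ring.
Qed.

(** The support of a bump at level [k] is a cube of side [3 * scale k]; this is the [q]-th power of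
    its Euclidean diameter. *)
Definition diam (q : R) (k : int) : R := (3 * Num.sqrt n%:R * scale k) `^ q.

Lemma bump_support (q : R) k c (x y : E) : 0 < q ->
  bump k c x != 0 -> bump k c y != 0 -> pow_dist n q x y <= diam q k.
Proof.
move=> q0 bx by_; rewrite /pow_dist /diam ge0_ler_powR ?(ltW q0)//.
- by rewrite nnegrE sqrtr_ge0.
- by rewrite nnegrE !mulr_ge0 ?sqrtr_ge0// ltW// scale_gt0.
have sk : 0 < scale k :> R := scale_gt0 k.
rewrite -(ler_pXn2r (n := 2)) ?nnegrE ?sqrtr_ge0// ?mulr_ge0 ?sqrtr_ge0 ?(ltW sk)//.
rewrite sqr_sqrtr; last by apply: sumr_ge0 => i _; exact: sqr_ge0.
rewrite !exprMn sqr_sqrtr//.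
apply: (@le_trans _ _ (\sum_(i < n) (3 * scale k) ^+ 2)).
  apply: ler_sum => i _; rewrite !mxE.
  have /andP[h1 h2] := cell_neq0 i bx; have /andP[h3 h4] := cell_neq0 i by_.
  have xE : coord i x = coord i x / scale k * scale k by rewrite divfK ?gt_eqF.
  have yE : coord i y = coord i y / scale k * scale k by rewrite divfK ?gt_eqF.
  rewrite -[x ord0 i]/(coord i x) -[y ord0 i]/(coord i y) xE yE -mulrBl !exprMn.
  rewrite ler_wpM2r ?sqr_ge0//.
  move: h1 h2 h3 h4; move: (coord i x / _) (coord i y / _) (_%:~R) => a b z; nra.
by rewrite sumr_const card_ord -mulr_natl exprMn; rewrite le_eqVlt; apply/orP;
  left; apply/eqP; ring.
Qed.

End euclidean.

(** * Comparison of the transport cost with weighted bump masses *)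

Section embedding.
Context {R : realType} (n : nat).
Variable q : R.
Hypothesis q01 : 0 < q < 1.
Local Notation E := (borelRn R n).
Local Notation Zn := {ffun 'I_n -> int}.

Definition bump_mass (P : probability E R) (kc : int * Zn) : R :=
  fine (\int[P]_x (bump kc.1 kc.2 x)%:E).

Lemma bump_ge0 k c (x : E) : 0 <= bump k c x.
Proof. exact: cell_ge0. Qed.

Lemma esum_bump k (x : E) : (\esum_(c in [set: Zn]) (bump k c x)%:E = 1)%E.
Proof. exact: esum_cell. Qed.

Lemma bump_le1 k c (x : E) : bump k c x <= 1.
Proof.
apply: (phi_le1 (phi := fun j c x => bump k c x) _ _ 0).
- by move=> _ ? ?; exact: bump_ge0.
- by move=> _ ?; exact: esum_bump.
Qed.

Lemma upper_const_gt0 : 0 < upper_const q.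
Proof.
by rewrite /upper_const !mulr_gt0 ?powR_gt0 ?sqrtr_gt0 ?level_const_gt0.
Qed.

(** The pointwise estimate [bump_pow_dist] is integrated. With general [X] and [Y] the result covers
    couplings and, for constant [Y], the comparison of a law with a Dirac mass. *)
Lemma upper_bound d (O : measurableType d) (mu : probability O R)
    (X Y : O -> E) : measurable_fun setT X -> measurable_fun setT Y ->
  (\esum_(kc in [set: int * Zn]) (scale kc.1 `^ q *
     `|fine (\int[mu]_w (bump kc.1 kc.2 (X w))%:E) -
       fine (\int[mu]_w (bump kc.1 kc.2 (Y w))%:E)|)%:E <=
   (upper_const q)%:E * \int[mu]_w (pow_dist n q (X w) (Y w))%:E)%E.
Proof.
move=> mX mY.
have mb Z k c : measurable_fun setT Z ->
  measurable_fun setT (fun w : O => bump k c (Z w : E)).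
  by move=> mZ; apply: measurableT_comp mZ; exact: measurable_bump.
have C0 := ltW upper_const_gt0.
rewrite -ge0_integralZl_EFin//; last 2 first.
- by move=> w _; rewrite lee_fin pow_dist_ge0.
- exact/measurable_EFinP/measurable_pow_dist_comp.
apply: (@le_trans _ _ (\int[mu]_w \esum_(kc in [set: int * Zn])
   (scale kc.1 `^ q * `|bump kc.1 kc.2 (X w) - bump kc.1 kc.2 (Y w)|)%:E)%E);
     last first.
  apply: ge0_le_integral => //.
  - by move=> w _; apply: esum_ge0 => kc _; rewrite lee_fin mulr_ge0// powR_ge0.
  - apply: measurable_esum => kc.
      by move=> w; rewrite lee_fin mulr_ge0// powR_ge0.
    apply/measurable_EFinP; apply: measurable_funM => //.
    apply: measurableT_comp => //; apply: measurable_funB; exact: mb.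
  - apply: measurable_funeM; exact/measurable_EFinP/measurable_pow_dist_comp.
  - by move=> w _; rewrite -EFinM; exact: bump_pow_dist.
rewrite integral_esum//; last 2 first.
- by move=> kc w; rewrite lee_fin mulr_ge0// powR_ge0.
- move=> kc; apply/measurable_EFinP; apply: measurable_funM => //.
  apply: measurableT_comp => //; apply: measurable_funB; exact: mb.
apply: le_esum => -[k c] _ /=.
rewrite [leRHS](eq_integral (fun w => (scale k `^ q)%:E * `|bump k c (X w) - bump k
  c (Y w)|%:E)%E); last first.
  by move=> w _; rewrite EFinM.
rewrite ge0_integralZl_EFin ?powR_ge0//; last first.
  apply/measurable_EFinP; apply: measurableT_comp => //; apply: measurable_funB;
    exact: mb.
rewrite EFinM lee_wpmul2l ?lee_fin ?powR_ge0//.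
have ib Z : measurable_fun setT Z ->
  mu.-integrable setT (fun w => (bump k c (Z w : E))%:E).
  move=> mZ; apply: (le_integrable measurableT _ _ (finite_measure_integrable_cst
    mu 1 measurableT)) => //.
  - exact/measurable_EFinP/mb.
  - by move=> w _ /=; rewrite lee_fin !ger0_norm ?bump_ge0// bump_le1.
have fX := integrable_fin_num measurableT (ib X mX).
have fY := integrable_fin_num measurableT (ib Y mY).
rewrite [leLHS](_ : _ = `|\int[mu]_w (bump k c (X w))%:E -
    \int[mu]_w (bump k c (Y w))%:E|%E).
  rewrite -integralB_EFin; [|by []|exact: ib|exact: ib].
  apply: (le_trans (le_abse_integral mu measurableT _)) => //.
  by apply/measurable_EFinP; apply: measurable_funB; exact: mb.
by rewrite -[in RHS](fineK fX) -[in RHS](fineK fY).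
Qed.

Definition mass_dist (P Q : probability E R) : \bar R :=
  (\esum_(kc in [set: int * Zn])
    (scale kc.1 `^ q * `|bump_mass P kc - bump_mass Q kc|)%:E)%E.

Lemma integral_law d (O : measurableType d) (mu : probability O R) (X : {RV mu >-> E})
    (P : probability E R) (f : E -> \bar R) :
  (forall A, measurable A -> distribution mu X A = P A) ->
  measurable_fun setT f -> (forall x, (0 <= f x)%E) ->
  (\int[mu]_w f (X w) = \int[P]_x f x)%E.
Proof.
move=> XP mf f0; rewrite -[LHS](ge0_integral_distribution (P := mu))//.
by apply: eq_measure_integral => A mA _; exact: XP.
Qed.

Lemma mass_dist_le_cost (P Q : probability E R) :
  (mass_dist P Q <= (upper_const q)%:E * transport_cost (pow_dist n q) P Q)%E.
Proof.
rewrite -lee_pdivrMl ?upper_const_gt0//.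
apply: le_ereal_inf_tmp => _ [dW [W [mu [X [Y [XP YQ ->]]]]]].
rewrite lee_pdivrMl ?upper_const_gt0// unlock.
apply: le_trans (upper_bound mu (measurable_funPT X) (measurable_funPT Y)).
rewrite le_eqVlt; apply/orP; left; apply/eqP; apply: eq_esum => kc _.
have mb : measurable_fun setT (fun x : E => (bump kc.1 kc.2 x)%:E).
  by apply/measurable_EFinP; exact: measurable_bump.
have b0 (x : E) : (0 <= (bump kc.1 kc.2 x)%:E)%E by rewrite lee_fin bump_ge0.
by rewrite (integral_law XP mb b0) (integral_law YQ mb b0).
Qed.

Section lower.
Variables P Q : probability E R.
Local Notation level_dist k := (\esum_(c in [set: Zn]) `|bump_mass P (k, c) -
  bump_mass Q (k, c)|%:E)%E.

(** The increment of [diam] between consecutive levels, relative to [2^(kq)]; it is halved because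
    the unmatched mass is half of the l1 distance. *)
Definition lower_const : R := (3 * Num.sqrt n%:R) `^ q * (2 `^ q - 1) / 2.

Lemma diamE k : diam n q k = (3 * Num.sqrt n%:R) `^ q * scale k `^ q.
Proof. by rewrite /diam powRM ?mulr_ge0 ?sqrtr_ge0 ?(ltW (scale_gt0 _)). Qed.

Lemma scaleD1_powR k : scale (k + 1) `^ q = 2 `^ q * scale k `^ q :> R.
Proof. by rewrite scaleD1 powRM ?(ltW (scale_gt0 _)). Qed.

Lemma lower_const_ge0 : 0 <= lower_const.
Proof. by rewrite divr_ge0// mulr_ge0 ?powR_ge0// subr_ge0 ltW// two_powR_gt1//;
  case/andP: q01. Qed.

Lemma diamD1 k : diam n q (k + 1) - diam n q k = 2 * lower_const * scale k `^ q.
Proof. by rewrite !diamE scaleD1_powR /lower_const; lra. Qed.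

Lemma diam_nondecreasing k : diam n q k <= diam n q (k + 1).
Proof.
rewrite -subr_ge0 diamD1 mulr_ge0 ?powR_ge0//.
by rewrite mulr_ge0 ?lower_const_ge0.
Qed.

Lemma mass_dist_levels (k0 : int) :
  (\sum_(j <oo) (scale (k0 + j%:Z) `^ q)%:E * level_dist (k0 + j%:Z)%R <= mass_dist
    P Q)%E.
Proof.
rewrite /mass_dist -(@pair_esum R int _ (fun k c =>
  (scale k `^ q * `|bump_mass P (k, c) - bump_mass Q (k, c)|)%:E)); last first.
  by move=> k c; rewrite lee_fin mulr_ge0 ?powR_ge0.
rewrite (esum_int_split (k0 - 1)); last first.
  by move=> k; apply: esum_ge0 => c _; rewrite lee_fin mulr_ge0 ?powR_ge0.
have ld0 k : (0 <= level_dist k)%E by apply: esum_ge0 => c _; rewrite lee_fin.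
rewrite nneseries_esumT => [|j]; last by rewrite mule_ge0 ?lee_fin ?powR_ge0.
rewrite -[leLHS]add0e; apply: leeD.
  by apply: esum_ge0 => j _; apply: esum_ge0 => c _; rewrite lee_fin mulr_ge0 ?powR_ge0.
by apply: le_esum => j _; rewrite subrK -esumZl ?powR_ge0.
Qed.

(** Matching starts at level [k0]. The initial cost is at most [diam n q k0], and the increments at
    later levels are charged to [mass_dist]. *)
Lemma cost_le_diam_mass_dist (k0 : int) : (mass_dist P Q < +oo)%E ->
  (transport_cost (pow_dist n q) P Q <=
     (diam n q k0)%:E + lower_const%:E * mass_dist P Q)%E.
Proof.
move=> dfin; have /andP[q0 q1] := q01.
have kS (j : nat) : k0 + j.+1%:Z = (k0 + j%:Z) + 1 by lia.
pose phi (j : nat) c (x : E) := bump (k0 + j%:Z) c x.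
have phi0 j c x : 0 <= phi j c x by exact: bump_ge0.
have mphi j c : measurable_fun setT (phi j c) by exact: measurable_bump.
have phi1 j x : (\esum_(c in [set: Zn]) (phi j c x)%:E = 1)%E by exact: esum_bump.
have phiL j c' x : (\esum_(c in [set: Zn]) (coarsen c c' * phi j c x)%:E =
    (phi j.+1 c' x)%:E)%E.
  rewrite /phi /bump esum_coarsen_cell; congr (cell _ _)%:E; apply/funext => i.
  by rewrite kS scaleD1 invfM mulrA mulrAC.
pose p := level_mass phi P; pose r := level_mass phi Q.
have cp := consistent_level_mass (@coarsen_ge0 R n) phi0 mphi phi1 phiL P.
have cr := consistent_level_mass (@coarsen_ge0 R n) phi0 mphi phi1 phiL Q.
have UE j : (\esum_(c in [set: Zn]) `|p j c - r j c|%:E = (2 * unmatched p r j)%:E)%E.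
  have fin := esum_dist_fin cp cr j.
  by rewrite -[LHS](fineK fin) /unmatched mulrC divfK.
have ldE j : (level_dist (k0 + j%:Z)%R = (2 * unmatched p r j)%:E)%E by exact: UE.
have U0 j : 0 <= unmatched p r j by exact: unmatched_ge0.
have term0 j : (0 <= (scale (k0 + j%:Z) `^ q)%:E * level_dist (k0 + j%:Z)%R)%E.
  by rewrite ldE lee_fin mulr_ge0 ?powR_ge0// mulr_ge0.
have sumfin : (\sum_(j <oo) (scale (k0 + j%:Z) `^ q)%:E * level_dist (k0 + j%:Z)%R
  < +oo)%E.
  exact: le_lt_trans (mass_dist_levels k0) dfin.
have scale_mono j : scale k0 `^ q <= scale (k0 + j%:Z) `^ q :> R.
  rewrite ge0_ler_powR ?nnegrE ?(ltW (scale_gt0 _))//; first exact: ltW.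
  by rewrite /scale; apply: ler_powR; rewrite ?ler1n// ler_int; lia.
have sk0 : 0 < scale k0 `^ q :> R by rewrite powR_gt0// scale_gt0.
apply: (@le_trans _ _ ((diam n q (k0 + 0%:Z))%:E +
  \sum_(j <oo) ((diam n q (k0 + j.+1%:Z) - diam n q (k0 + j%:Z)) *
    unmatched p r j)%:E)%E).
  apply: (@transport_cost_le_matching _ _ _ _ phi (@coarsen R n) _ _ phi0 mphi phi1 phiL
     (pow_dist n q) (fun j => diam n q (k0 + j%:Z)) P Q).
  - exact: coarsen_ge0.
  - exact: esum_coarsen.
  - by move=> x y; exact: pow_dist_ge0.
  - by apply: measurable_pow_dist_comp; [exact: measurable_fst|exact: measurable_snd].
  - by move=> j; exact: powR_ge0.
  - by move=> j c x y; exact: bump_support.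
  - by move=> j; rewrite kS; exact: diam_nondecreasing.
  (* The weights are at least the one at [k0], so the unmatched mass is controlled by a tail of a
     convergent series and tends to 0. *)
  - have tail := nneseries_tail_cvg sumfin (fun j _ => term0 j).
    have /= tail2 := cvgeZl (y := ((2 * scale k0 `^ q)^-1)%:E) isT tail.
    rewrite mule0 in tail2.
    apply: (@fine_cvg _ _ _ _ (fun j => (unmatched p r j)%:E)).
    apply: (squeeze_cvge _ (cvg_cst _) tail2); apply: nearW => j.
    rewrite lee_fin U0/= lee_pdivlMl ?mulr_gt0//.
    apply: (@le_trans _ _ ((scale (k0 + j%:Z) `^ q)%:E * level_dist (k0 + j%:Z)%R)%E).
      rewrite ldE -!EFinM lee_fin; move: (U0 j) (scale_mono j).
      move: (unmatched _ _ _) (scale k0 `^ q) (scale _ `^ q) => u a b u0 ab.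
      by rewrite -mulrA mulrCA ler_wpM2r// mulr_ge0.
    apply: le_trans (nneseries_lim_ge j.+1 _); first by rewrite big_nat1.
    by move=> i _ _; exact: term0.
rewrite addr0 leeD2l//.
apply: (@le_trans _ _ (lower_const%:E * \sum_(j <oo) (scale (k0 + j%:Z) `^ q)%:E *
  level_dist (k0 + j%:Z)%R)%E); last first.
  by rewrite lee_wpmul2l ?lee_fin ?lower_const_ge0// mass_dist_levels.
rewrite -nneseriesZl//.
apply: lee_nneseries => [j _ _|j _]; rewrite kS diamD1.
  rewrite lee_fin mulr_ge0 ?U0// mulr_ge0 ?powR_ge0//.
  by rewrite mulr_ge0 ?lower_const_ge0.
rewrite ldE -!EFinM lee_fin.
by rewrite le_eqVlt; apply/orP; left; apply/eqP; ring.
Qed.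

Lemma diam_small (e : R) : 0 < e -> (0 < n)%N -> exists k : int, diam n q k <= e.
Proof.
move=> e0 n0; have /andP[q0 _] := q01.
have a0 : 0 < 3 * Num.sqrt n%:R :> R by rewrite mulr_gt0// sqrtr_gt0 ltr0n.
(* Chosen so that [3 * sqrt n * scale k] is at most [e^(1/q)]. *)
have [k [ke _]] := @log2_floor R (e `^ q^-1 / (3 * Num.sqrt n%:R)) (divr_gt0
  (powR_gt0 _ e0) a0).
exists k; rewrite -[leRHS](powRr1 (ltW e0)) -(mulVf (lt0r_neq0 q0)) powRrM /diam.
rewrite ge0_ler_powR ?nnegrE ?(ltW q0) ?powR_ge0 ?mulr_ge0 ?(ltW (scale_gt0 _))
  ?sqrtr_ge0//.
by rewrite mulrC -ler_pdivlMr.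
Qed.

(** Starting from ever finer levels makes the initial cost arbitrarily small. *)
Lemma cost_le_mass_dist : (0 < n)%N -> (mass_dist P Q < +oo)%E ->
  (transport_cost (pow_dist n q) P Q <= lower_const%:E * mass_dist P Q)%E.
Proof.
move=> n0 dfin; apply/lee_addgt0Pr => e e0.
have [k ke] := diam_small e0 n0.
apply: (le_trans (cost_le_diam_mass_dist k dfin)).
by rewrite addeC leeD2l// lee_fin.
Qed.

End lower.
End embedding.

(** * The embedding *)

Section constants.
Context {R : realType}.
Variable q : R.
Hypothesis q01 : 0 < q < 1.

(** Young's inequality for [2^q * 1] with exponents [1/q] and [1/(1-q)], whose right side is
    [2q + (1 - q)]. *)
Lemma two_powR_le : 2 `^ q <= 1 + q :> R.
Proof.
have /andP[q0 q1] := q01.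
have := @conjugate_powR R (2 `^ q) 1 q^-1 (1 - q)^-1 (powR_ge0 _ _) ler01.
rewrite -powRrM divff ?gt_eqF// powRr1// powR1 !invrK mulr1.
have a : 0 < q^-1 by rewrite invr_gt0.
have b : 0 < (1 - q)^-1 by rewrite invr_gt0; lra.
have c : q + (1 - q) = 1 by lra.
move=> /(_ a b c); lra.
Qed.

Lemma lower_const_gt0 n : (0 < n)%N -> 0 < lower_const n q.
Proof.
move=> n0; have /andP[q0 _] := q01.
rewrite /lower_const divr_gt0// mulr_gt0 ?subr_gt0 ?two_powR_gt1//.
by rewrite powR_gt0// mulr_gt0// sqrtr_gt0 ltr0n.
Qed.

(* With [s = 2 `^ q <= 1 + q], the two geometric series add up to
   [(s - 1) * level_const q = s + 2 (s - 1) / (2 - s)]. *)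
Lemma level_const_le : (1 - q) * ((2 `^ q - 1) * level_const q) <= 2.
Proof.
have /andP[q0 q1] := q01.
rewrite /level_const powRN powRB ?powRr1 ?pnatr_eq0 ?implybT//.
have := two_powR_gt1 q0; have := two_powR_le; move: (2 `^ q) => s sq s1.
rewrite (_ : (s - 1) * _ = s + 2 * (s - 1) / (2 - s)); last by field; apply/and3P;
  split; apply/eqP; lra.
have h : 2 * (s - 1) / (2 - s) <= 2 * q / (1 - q).
  rewrite ler_pdivrMr; last by lra.
  rewrite mulrAC ler_pdivlMr; last by lra.
  nra.
(* This product equals [2 - (1 - q) ^+ 2]. *)
apply: (@le_trans _ _ ((1 - q) * (1 + q + 2 * q / (1 - q)))).
  by rewrite ler_wpM2l ?lerD//; lra.
rewrite mulrDr mulrCA divff ?mulr1; last by apply/eqP; lra.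
nra.
Qed.

(** Apart from the power of [n], the factors are at most 3/2, 3 and 2, with product 9, below
    10.55. *)
Lemma const_le n : upper_const q * lower_const n q <=
  1055 / 100 * n%:R `^ (q / 2) / (1 - q).
Proof.
have /andP[q0 q1] := q01.
have q10 : 0 < 1 - q by lra.
rewrite /upper_const /lower_const powRM ?sqrtr_ge0//.
rewrite -[Num.sqrt n%:R]powR12_sqrt// -powRrM (mulrC 2^-1).
have t0 := powR_ge0 (n%:R : R) (q / 2).
have h3 : 3 `^ q <= 3 :> R by apply: ler1_powR; lra.
have h2 : Num.sqrt 2 `^ q <= Num.sqrt 2 :> R.
  by apply: ler1_powR; [rewrite -[leLHS]sqrtr1 ler_sqrt; lra|lra].
have s2 : Num.sqrt 2 <= 3 / 2 :> R.
  rewrite -[leRHS]ger0_norm; last by lra.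
  by rewrite -sqrtr_sqr ler_sqrt; lra.
rewrite ler_pdivlMr//.
have -> : 2 * Num.sqrt 2 `^ q * level_const q *
    (3 `^ q * n%:R `^ (q / 2) * (2 `^ q - 1) / 2) * (1 - q) =
    Num.sqrt 2 `^ q * 3 `^ q * ((1 - q) * ((2 `^ q - 1) * level_const q)) *
    n%:R `^ (q / 2) by field.
rewrite ler_wpM2r//; apply: (@le_trans _ _ (3 / 2 * 3 * 2)); last by lra.
have L0 : 0 <= (1 - q) * ((2 `^ q - 1) * level_const q).
  rewrite mulr_ge0 ?(ltW q10)// mulr_ge0 ?(ltW (level_const_gt0 q01))//.
  by rewrite subr_ge0 ltW// two_powR_gt1.
apply: ler_pM => //; last exact: level_const_le.
by apply: ler_pM; rewrite ?powR_ge0//; exact: le_trans s2.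
Qed.

End constants.

(** * The coefficient map and its bi-Lipschitz constants *)

Section l1_embedding.
Context {R : realType} (n : nat).
Variable q : R.
Hypothesis q01 : 0 < q < 1.
Local Notation E := (borelRn R n).
Local Notation Zn := {ffun 'I_n -> int}.
Local Notation dist := (@pow_dist R n q).

(* Subtracting the value at the Dirac mass at the origin makes the family
   summable without changing differences. *)
Definition coef (P : probability E R) (kc : int * Zn) : R :=
  scale kc.1 `^ q * (bump_mass P kc - bump kc.1 kc.2 (0 : 'rV[R]_n)).

Definition coef_seq (P : probability E R) (i : nat) : R :=
  oapp (coef P) 0 (pickle_inv i).

(** Otherwise the inner integral would be [+oo] everywhere, and so would the double integral. *)
Lemma finite_moment (P : probability E R) : finite_mean_dist dist P ->
  exists y, (\int[P]_x (dist x y)%:E < +oo)%E.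
Proof.
move=> Pfin; apply: contrapT => /forallNP h.
have {}h y : (\int[P]_x (dist x y)%:E = +oo)%E.
  by apply/eqP; rewrite -leye_eq leNgt; apply/negP/h.
move: Pfin; rewrite /finite_mean_dist; under eq_integral do rewrite h.
by rewrite integral_cst// [X in (_ * X)%E]probability_setT mule1.
Qed.

(** Triangle inequality through a point [y] of finite moment: [upper_bound] compares [P] with the
    Dirac mass at [y], and [bump_pow_dist] compares [y] with the origin. *)
Lemma esum_coef_fin (P : probability E R) : finite_mean_dist dist P ->
  (\esum_(kc in [set: int * Zn]) `|coef P kc|%:E < +oo)%E.
Proof.
move=> /finite_moment [y Py].
have mid : measurable_fun setT (fun x : E => x) by exact: measurable_id.
have mcst : measurable_fun setT (fun _ : E => y) by exact: measurable_cst.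
have up := upper_bound q01 P mid mcst.
have up2 := bump_pow_dist y (0 : 'rV[R]_n) q01.
apply: (@le_lt_trans _ _ ((upper_const q)%:E * \int[P]_x (dist x y)%:E +
   (upper_const q * dist y (0 : 'rV[R]_n))%:E)%E); last first.
  rewrite lte_add_pinfty ?ltry// lte_mul_pinfty// lee_fin.
  exact/ltW/upper_const_gt0.
apply: le_trans (leeD up up2).
rewrite -esumD => [|kc _|kc _]; last 2 first.
- by rewrite lee_fin mulr_ge0 ?powR_ge0.
- by rewrite lee_fin mulr_ge0 ?powR_ge0.
apply: le_esum => kc _; rewrite -EFinD lee_fin /coef normrM ger0_norm ?powR_ge0//.
rewrite -mulrDr ler_wpM2l ?powR_ge0//.
have -> : fine (\int[P]_w (bump kc.1 kc.2 y)%:E) = bump kc.1 kc.2 y.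
  by rewrite integral_cst// [X in (_ * X)%E]probability_setT mule1.
by rewrite -[leLHS](_ : `|bump_mass P kc - bump kc.1 kc.2 y +
  (bump kc.1 kc.2 y - bump kc.1 kc.2 (0 : 'rV[R]_n))| = _) ?ler_normD// addrA subrK.
Qed.

Lemma coef_seq_fin (P : probability E R) : finite_mean_dist dist P ->
  (\sum_(i <oo) `|coef_seq P i|%:E < +oo)%E.
Proof.
move=> /esum_coef_fin; rewrite esumT_pickle_inv; last by move=> kc; rewrite lee_fin.
congr (_ < _)%E; apply: eq_eseriesr => i _; rewrite /coef_seq.
by case: pickle_inv => //=; rewrite normr0.
Qed.

Lemma coef_seq_dist (P Q : probability E R) :
  (\sum_(i <oo) `|coef_seq P i - coef_seq Q i|%:E = mass_dist q P Q)%E.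
Proof.
rewrite /mass_dist esumT_pickle_inv; last first.
  by move=> kc; rewrite lee_fin mulr_ge0 ?powR_ge0.
apply: eq_eseriesr => i _; rewrite /coef_seq; case: pickle_inv => [kc|] /=; last first.
  by rewrite subr0 normr0.
rewrite /coef -mulrBr opprB addrA subrK normrM ger0_norm ?powR_ge0//.
Qed.

Lemma mass_dist_fin (P Q : probability E R) :
  finite_mean_dist dist P -> finite_mean_dist dist Q ->
  (mass_dist q P Q < +oo)%E.
Proof.
move=> /coef_seq_fin Pf /coef_seq_fin Qf; rewrite -coef_seq_dist.
apply: le_lt_trans (lte_add_pinfty Pf Qf).
rewrite -nneseriesD//; apply: lee_nneseries => // i _.
by rewrite -EFinD lee_fin ler_normB.
Qed.

Definition Pd_embedding (P : Pd dist) : L1 R :=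
  L1_of_l1 (exist _ (coef_seq (sval P)) (coef_seq_fin (svalP P))).

Lemma Pd_embedding_dist P Q :
  L1_dist (Pd_embedding P) (Pd_embedding Q) = mass_dist q (sval P) (sval Q).
Proof. by rewrite L1_of_l1_dist coef_seq_dist. Qed.

Lemma Pd_embedding_bi_lipschitz : (0 < n)%N ->
  bi_lipschitz (Pd_dist dist) (@L1_dist R) (upper_const q) (lower_const n q)
    Pd_embedding.
Proof.
move=> n0; split; [exact: upper_const_gt0|exact: lower_const_gt0|move=> P Q].
rewrite Pd_embedding_dist; split; last exact: mass_dist_le_cost.
rewrite lee_pdivrMl ?lower_const_gt0//; apply: cost_le_mass_dist => //.
exact: mass_dist_fin (svalP P) (svalP Q).
Qed.

End l1_embedding.

Theorem proposition41 (R : realType) (n : nat) (q : R)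
  (hn : (1 <= n)%N) (hq0 : 0 < q) (hq1 : q < 1) :
  exists f : Pd (pow_dist n q) -> L1 R,
    (exists r1 r2 : R,
      bi_lipschitz (Pd_dist (pow_dist n q)) (@L1_dist R) r1 r2 f) /\
    (distortion (Pd_dist (pow_dist n q)) (@L1_dist R) f
       <= ((1055 / 100) * n%:R `^ (q / 2) / (1 - q))%:E)%E.
Proof.
have q01 : 0 < q < 1 by rewrite hq0.
have bl := Pd_embedding_bi_lipschitz q01 hn.
exists (Pd_embedding q01); split; first by exists (upper_const q), (lower_const n q).
apply: (@le_trans _ _ (upper_const q * lower_const n q)%:E).
  by apply: ereal_inf_lbound; exists (upper_const q), (lower_const n q).
by rewrite lee_fin const_le.
Qed.
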